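(* Let $d=d(n)$ be a sequence of positive integers, and assume that there exists a constant $\epsilon>0$ such that $d(n)\le n^{1-\epsilon}$ for all sufficiently large $n$. For each $n$, let $X_n$ be the random variable counting the $d(n)$-descents of a uniformly random permutation of $\{1,2,\dots,n\}$. Then, as $n\to\infty$, the standardized variable $\tilde{X}_n=(X_n-E(X_n))/\sqrt{\mathrm{Var}(X_n)}$ converges in distribution to the standard normal distribution $N(0,1)$.
   Context: For a permutation $p=p_1p_2\cdots p_n$ of $\{1,\dots,n\}$ and a positive integer $d$, a pair of indices $(i,j)$ with $1\le i<j\le n$ is called a $d$-descent of $p$ if $j\le i+d$ and $p_i>p_j$. For a random variable $Z$ with finite positive variance, $\tilde{Z}=(Z-E(Z))/\sqrt{\mathrm{Var}(Z)}$. (The variance of $X_n$ is positive for $n\ge 2$, so the definition of $\tilde X_n$ makes sense for such $n$.) *)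

(* Defs.v *)
(* MathComp / MathComp-Analysis *)
From HB Require Import structures.
From mathcomp Require Import all_boot all_order all_algebra perm.
From mathcomp Require Import finmap.
From mathcomp Require Import all_classical all_reals all_analysis.
From mathcomp Require Import measurable_realfun.

Set Implicit Arguments.
Unset Strict Implicit.
Unset Printing Implicit Defensive.

Import Order.TTheory GRing.Theory Num.Theory.
Import numFieldNormedType.Exports.

Local Open Scope classical_set_scope.
Local Open Scope ring_scope.

(* Permutations carry the discrete sigma-algebra. The instances are attached to
   perm_type, the head constant to which the notation {perm T} unfolds. *)
HB.instance Definition _ (T : finType) :=
  isPointed.Build (perm_type T) (@perm_one T).
HB.instance Definition _ (T : finType) :=
  @isMeasurable.Build default_measure_display (perm_type T)
    (@discrete_measurable (perm_type T)) (@discrete_measurable0 (perm_type T))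
    (@discrete_measurableC (perm_type T)) (@discrete_measurableU (perm_type T)).

Lemma measurable_fun_perm (T : finType) (disp : measure_display)
    (U : measurableType disp) (f : {perm T} -> U) : measurable_fun setT f.
Proof. by []. Qed.

Definition perm_uniform (R : realType) (n : nat) : set 'S_n -> \bar R :=
  mscale ((n`!)%:R^-1)%:nng (@counting 'S_n R).
Arguments perm_uniform : clear implicits.

HB.instance Definition _ (R : realType) (n : nat) :=
  Measure.on (perm_uniform R n).

Lemma perm_uniformE (R : realType) (n : nat) (A : set 'S_n) :
  perm_uniform R n A = (#|[pred p | p \in A]|%:R / n`!%:R)%:E.
Proof.
rewrite /perm_uniform /mscale /= /counting asboolT; last exact: finite_finset.
rewrite -EFinM mulrC; congr (_%:R / _)%:E.
rewrite cardE; apply/perm_size/uniq_perm; rewrite ?fset_uniq ?enum_uniq// => p.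
by rewrite mem_enum !inE (in_fset_set finite_finset).
Qed.

Lemma perm_uniform_setT (R : realType) (n : nat) :
  perm_uniform R n [set: 'S_n] = 1%E.
Proof.
rewrite perm_uniformE (_ : #|_| = n`!).
  by rewrite divff// pnatr_eq0 -lt0n fact_gt0.
by rewrite -card_Sn; apply: eq_card => p; rewrite !inE in_setT.
Qed.

HB.instance Definition _ (R : realType) (n : nat) :=
  Measure_isProbability.Build _ _ _ (perm_uniform R n)
    (perm_uniform_setT R n).

(* The 0-based 'I_n stands for {1, ..., n}, for positions and for values: only
   their relative order (and the difference of positions) matters. *)
Definition d_descents (n d : nat) (p : 'S_n) : nat :=
  #|[pred ij : 'I_n * 'I_n |
      [&& (ij.1 < ij.2)%N, (ij.2 <= ij.1 + d)%N & (p ij.2 < p ij.1)%N]]|.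

Definition d_descentsRV (R : realType) (n d : nat) (p : 'S_n) : R :=
  (d_descents d p)%:R.
Arguments d_descentsRV : clear implicits.

HB.instance Definition _ (R : realType) (n d : nat) :=
  isMeasurableFun.Build _ _ 'S_n R (d_descentsRV R n d)
    (@measurable_fun_perm _ _ _ (d_descentsRV R n d)).

Definition standardize (disp : measure_display) (T : measurableType disp)
    (R : realType) (P : probability T R) (X : T -> R) : T -> R :=
  fun w => (X w - fine 'E_P[X]) / Num.sqrt (fine 'V_P[X]).

Lemma measurable_standardize (disp : measure_display) (T : measurableType disp)
    (R : realType) (P : probability T R) (X : {RV P >-> R}) :
  measurable_fun setT (standardize P X).
Proof. by apply: measurable_funM => //; exact: measurable_funB. Qed.

HB.instance Definition _ (disp : measure_display) (T : measurableType disp)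
    (R : realType) (P : probability T R) (X : {RV P >-> R}) :=
  isMeasurableFun.Build _ _ T R (standardize P X) (measurable_standardize X).

(* Convergence in distribution of X n to the law mu: pointwise convergence of
   the distribution functions at the continuity points of that of mu. The X n
   may live on different probability spaces. *)
Definition cvg_in_distribution (R : realType) (disp : nat -> measure_display)
    (T : forall n, measurableType (disp n)) (P : forall n, probability (T n) R)
    (X : forall n, {RV (P n) >-> R})
    (mu : probability (measurableTypeR R) R) : Prop :=
  forall x : R, {for x, continuous (fun t : R => mu `]-oo, t]%classic)} ->
    cdf (X n) x @[n --> \oo] --> mu `]-oo, x]%classic.
Arguments cvg_in_distribution {R disp T} P X mu.

(* Main.v *)
(* Hoeffding decomposition followed by Stein's method. Replace the permutation by
   a word of n independent uniform letters in {0, ..., M}; conditionally on its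
   letters being distinct (which has probability tending to 1 as M grows) its
   relative order is a uniform permutation. On words, the centered number of
   d-descents is the sum of
     - a linear part: the letter at i gets the coefficient (number of close
       positions to the right) - (number of close positions to the left), which
       vanishes unless i is within d of an end of the word;
     - a completely degenerate quadratic part over the close pairs.
   Let D_j be the linear term at j plus half of the quadratic terms involving j,
   and T_j the sum of all terms involving j. The total S is the sum of the D_j,
   and D_j has mean zero given the other letters, on which alone S - T_j depends.
   Hence E[S F(S)] is close to E[(sum_j D_j T_j) F'(S)], and sum_j D_j T_j
   concentrates around Var S >= (d^3 + n d) / 48 because distant terms are
   independent: the relative error is O(sqrt (d / n)), uniformly in M.
   Letting M tend to infinity gives E[W f(W) - f'(W)] -> 0 for the standardized
   number W of d-descents. If g is Lipschitz with compact support and Gaussian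
   mean zero, then g = f' - x f for some f with compact support, so E[g(W)] -> 0;
   applied to differences of trapezoids, together with E[W^2] = 1, this gives the
   convergence of the distribution functions. *)
Require Import Defs.
From HB Require Import structures.
From mathcomp Require Import all_boot all_order all_algebra perm.
From mathcomp Require Import finmap.
From mathcomp Require Import all_classical all_reals all_analysis.
From mathcomp Require Import measurable_realfun.
From mathcomp Require Import ring lra zify.

Set Implicit Arguments.
Unset Strict Implicit.
Unset Printing Implicit Defensive.

Import Order.TTheory GRing.Theory Num.Theory.
Import numFieldNormedType.Exports.

Local Open Scope ring_scope.

(** * Averages over words *)

Section Average.
Variables (R : realFieldType) (I T : finType).
Hypothesis T_gt0 : (0 < #|T|)%N.
Implicit Types (G Y Z : {ffun I -> T} -> R) (w : {ffun I -> T}).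

Definition avg G : R := (\sum_w G w) / #|{ffun I -> T}|%:R.

Lemma card_words_gt0 : (0 : R) < #|{ffun I -> T}|%:R.
Proof. by rewrite ltr0n card_ffun expn_gt0 T_gt0. Qed.

Lemma eq_avg G Y : G =1 Y -> avg G = avg Y.
Proof. by move=> GY; rewrite /avg (eq_bigr Y). Qed.

Lemma avgD G Y : avg (fun w => G w + Y w) = avg G + avg Y.
Proof. by rewrite /avg big_split /= mulrDl. Qed.

Lemma avgZ c G : avg (fun w => c * G w) = c * avg G.
Proof. by rewrite /avg -mulr_sumr mulrA. Qed.

Lemma avgN G : avg (fun w => - G w) = - avg G.
Proof. by rewrite /avg sumrN mulNr. Qed.

Lemma avgB G Y : avg (fun w => G w - Y w) = avg G - avg Y.
Proof. by rewrite avgD avgN. Qed.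

Lemma avg_cst c : avg (fun=> c) = c.
Proof.
by rewrite /avg sumr_const -[_ *+ _]mulr_natr mulfK// gt_eqF// card_words_gt0.
Qed.

Lemma avg_sum (J : Type) (r : seq J) (P : pred J) (G : J -> _ -> R) :
  avg (fun w => \sum_(j <- r | P j) G j w) = \sum_(j <- r | P j) avg (G j).
Proof. by rewrite /avg exchange_big mulr_suml. Qed.

Lemma avg_le G Y : (forall w, G w <= Y w) -> avg G <= avg Y.
Proof.
move=> GY; rewrite /avg ler_wpM2r ?invr_ge0 ?ler0n//.
by apply: ler_sum => w _.
Qed.

Lemma avg_ge0 G : (forall w, 0 <= G w) -> 0 <= avg G.
Proof. by move=> G0; rewrite -(avg_cst 0) avg_le. Qed.

Lemma ler_norm_avg G : `|avg G| <= avg (fun w => `|G w|).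
Proof.
rewrite /avg normrM normfV (gtr0_norm card_words_gt0).
by rewrite ler_wpM2r ?invr_ge0 ?ler0n// ler_norm_sum.
Qed.

Definition upd w (j : I) (u : T) : {ffun I -> T} :=
  [ffun i => if i == j then u else w i].

Lemma upd_same w j u : upd w j u j = u.
Proof. by rewrite ffunE eqxx. Qed.

Lemma upd_other w j u i : i != j -> upd w j u i = w i.
Proof. by rewrite ffunE => /negbTE ->. Qed.

(* The involution (w, u) |-> (w with u at j, w j) shows that resampling the
   letter at j preserves the uniform measure. *)
Lemma avg_resample j G :
  avg G = avg (fun w => (\sum_u G (upd w j u)) / #|T|%:R).
Proof.
rewrite /avg -mulr_suml; congr (_ / _).
apply: (mulIf (x := #|T|%:R)); first by rewrite pnatr_eq0 -lt0n.
rewrite mulfVK ?pnatr_eq0 -?lt0n// mulr_natr -sumr_const.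
rewrite exchange_big /= !pair_big /=.
pose h (p : {ffun I -> T} * T) := (upd p.1 j p.2, p.1 j).
have hK : involutive h.
  move=> [w u]; rewrite /h /= upd_same; congr (_, _).
  by apply/ffunP => i; rewrite !ffunE; case: eqP => // ->.
rewrite (reindex_inj (inv_inj hK)) /=.
rewrite -!(pair_big predT predT (fun w u => G (upd w j u))) /=.
by rewrite exchange_big.
Qed.

(** Resampling the letter at [j] alone, with the other letters frozen, makes [Z] a constant factor
    and averages [Y] to zero. *)
Lemma avg_centered j Y Z : (forall w, \sum_u Y (upd w j u) = 0) ->
  (forall w u, Z (upd w j u) = Z w) -> avg (fun w => Y w * Z w) = 0.
Proof.
move=> Y0 Zj; rewrite (avg_resample j) -[RHS](avg_cst 0); apply: eq_avg => w.
under eq_bigr do rewrite Zj.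
by rewrite -mulr_suml Y0 !mul0r.
Qed.

Lemma avg_centered1 j Y : (forall w, \sum_u Y (upd w j u) = 0) -> avg Y = 0.
Proof.
move=> Y0; rewrite -(@avg_centered j Y (fun=> 1))//.
by apply: eq_avg => w; rewrite mulr1.
Qed.

Lemma avg_letter j (phi : T -> R) :
  avg (fun w => phi (w j)) = (\sum_u phi u) / #|T|%:R.
Proof.
rewrite (avg_resample j) -[RHS]avg_cst; apply: eq_avg => w.
by under eq_bigr do rewrite upd_same.
Qed.

Lemma avg_two_letters i j (phi : T -> T -> R) : i != j ->
  avg (fun w => phi (w i) (w j)) = (\sum_s \sum_t phi s t) / #|T|%:R ^+ 2.
Proof.
move=> ij; rewrite (avg_resample i).
under eq_avg => w.
  under eq_bigr => u _ do rewrite upd_same upd_other 1?eq_sym//.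
  over.
rewrite (avg_letter j (fun t => (\sum_u phi u t) / _)).
by rewrite -mulr_suml exchange_big /= expr2 invfM mulrA.
Qed.

Definition depends_on (A : {set I}) Y :=
  forall w w', {in A, forall i, w i = w' i} -> Y w = Y w'.

(** Exchanging the letters in [B] between two words is an involution on pairs of words. It turns
    [Y w * Z w'] into [Y w * Z w]. *)
Lemma avg_indep (A B : {set I}) Y Z : depends_on A Y -> depends_on B Z ->
  [disjoint A & B] -> avg (fun w => Y w * Z w) = avg Y * avg Z.
Proof.
move=> YA ZB AB.
pose mix w w' : {ffun I -> T} := [ffun i => if i \in B then w' i else w i].
pose h (p : {ffun I -> T} * {ffun I -> T}) := (mix p.1 p.2, mix p.2 p.1).
have hK : involutive h.
  move=> [w w']; rewrite /h /=; congr (_, _).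
    by apply/ffunP => i; rewrite !ffunE; case: ifP => iB; rewrite ?iB.
  by apply/ffunP => i; rewrite !ffunE; case: ifP => iB; rewrite ?iB.
have Ymix w w' : Y (mix w w') = Y w.
  by apply: YA => i iA; rewrite ffunE (disjointFr AB iA).
have Zmix w w' : Z (mix w w') = Z w'.
  by apply: ZB => i iB; rewrite ffunE iB.
rewrite /avg mulf_div big_distrlr /= pair_big /= (reindex_inj (inv_inj hK)) /=.
under [in RHS]eq_bigr do rewrite Ymix Zmix.
rewrite -(pair_big predT predT (fun w _ => Y w * Z w)) /=.
under [in RHS]eq_bigr do rewrite sumr_const.
rewrite sumrMnl -[X in _ = X / _]mulr_natr -mulf_div divff ?mulr1//.
by rewrite gt_eqF// card_words_gt0.
Qed.

Lemma avg_sqr_center Y : avg (fun w => (Y w - avg Y) ^+ 2) <=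
  avg (fun w => Y w ^+ 2).
Proof.
have -> : avg (fun w => (Y w - avg Y) ^+ 2) =
    avg (fun w => Y w ^+ 2) - (avg Y) ^+ 2.
  transitivity (avg (fun w => Y w ^+ 2 - (avg Y *+ 2) * Y w + (avg Y) ^+ 2)).
    by apply: eq_avg => w; ring.
  by rewrite avgD avgB avgZ avg_cst; ring.
by rewrite gerBl sqr_ge0.
Qed.

(** In the expanded square, pairs with disjoint neighbourhoods have zero covariance. The others are
    bounded by half the sum of the two second moments; by symmetry of the overlap relation, each
    index is then charged at most [m] times. *)
Lemma avg_sqr_local_sum (J : finType) (N : J -> {set I}) (Y : J -> _ -> R)
    (m : nat) :
  (forall j, depends_on (N j) (Y j)) ->
  (forall j, #|[pred k | ~~ [disjoint N j & N k]]| <= m)%N ->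
  avg (fun w => (\sum_j (Y j w - avg (Y j))) ^+ 2) <=
    m%:R * \sum_j avg (fun w => Y j w ^+ 2).
Proof.
move=> YN Nm; pose y j w := Y j w - avg (Y j).
have yN j : depends_on (N j) (y j).
  by move=> w w' ww'; rewrite /y (YN j w w').
have y0 j : avg (y j) = 0 by rewrite avgB avg_cst subrr.
pose v j := avg (fun w => Y j w ^+ 2).
have yv j : avg (fun w => y j w ^+ 2) <= v j := avg_sqr_center _.
have v0 j : 0 <= v j by apply: avg_ge0 => w; exact: sqr_ge0.
have -> : avg (fun w => (\sum_j y j w) ^+ 2) =
    \sum_j \sum_k avg (fun w => y j w * y k w).
  transitivity (avg (fun w => \sum_j \sum_k y j w * y k w)).
    by apply: eq_avg => w; rewrite expr2 big_distrlr.
  by rewrite avg_sum; apply: eq_bigr => j _; rewrite avg_sum.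
pose a j k : R := (~~ [disjoint N j & N k])%:R.
have cov j k : avg (fun w => y j w * y k w) <= a j k * ((v j + v k) / 2).
  rewrite /a; have [NN|NN] := boolP [disjoint N j & N k].
    by rewrite (avg_indep (yN j) (yN k) NN) !y0 !mul0r.
  rewrite mul1r; apply: (le_trans (y := avg (fun w => (y j w ^+ 2 + y k w ^+ 2) / 2))).
    by apply: avg_le => w; have := sqr_ge0 (y j w - y k w); nra.
  under eq_avg do rewrite mulrC.
  rewrite avgZ avgD mulrC ler_wpM2r ?invr_ge0// lerD//.
have aC j k : a j k = a k j by rewrite /a disjoint_sym.
have a_sum j : \sum_k a j k <= m%:R.
  rewrite /a -natr_sum ler_nat (leq_trans _ (Nm j))//.
  rewrite -sum1_card [leqRHS]big_mkcond /= leq_sum//.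
apply: (le_trans (y := \sum_j \sum_k a j k * ((v j + v k) / 2))).
  by apply: ler_sum => j _; apply: ler_sum => k _; exact: cov.
have -> : \sum_j \sum_k a j k * ((v j + v k) / 2) = \sum_j \sum_k a j k * v j.
  transitivity ((\sum_j \sum_k a j k * v j + \sum_j \sum_k a j k * v k) / 2).
    rewrite -big_split /= mulr_suml; apply: eq_bigr => j _.
    by rewrite -big_split /= mulr_suml; apply: eq_bigr => k _; lra.
  rewrite [X in _ + X]exchange_big /=.
  under [X in _ + X]eq_bigr do under eq_bigr do rewrite aC.
  by lra.
rewrite mulr_sumr; apply: ler_sum => j _.
by rewrite -mulr_suml ler_wpM2r.
Qed.

End Average.

(** * Stein's method for degenerate sums *)

Section SteinWords.
Variables (R : realFieldType) (I T : finType).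
Hypothesis T_gt0 : (0 < #|T|)%N.
Variables (x : I -> T -> R) (e : I -> I -> T -> T -> R) (a : I -> R).
Variables (adj : rel I) (D m : nat).
Hypothesis x_centered : forall i, \sum_t x i t = 0.
Hypothesis x_bounded : forall i t, `|x i t| <= a i.
Hypothesis e_sym : forall i j s t, e i j s t = e j i t s.
Hypothesis e_centered : forall i j t, \sum_s e i j s t = 0.
Hypothesis e_bounded : forall i j s t, `|e i j s t| <= (adj i j)%:R.
Hypothesis adj_irr : irreflexive adj.
Hypothesis adj_degree : forall j, (#|[pred i | adj i j]| <= D)%N.
(** The positions whose letters enter the terms at [j]; terms with disjoint windows are
    independent. *)
Let window j := j |: [set i | adj i j].
Hypothesis window_degree :
  forall j, (#|[pred k | ~~ [disjoint window j & window k]]| <= m)%N.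
Implicit Types w : {ffun I -> T}.

Definition quad j w := \sum_i e i j (w i) (w j).
(** As [e] is symmetric, every unordered pair occurs twice in the sum of the [quad j], hence the
    division by 2. Accordingly [dpart j] gets half of each pair through [j], and [tpart j] all of
    it. *)
Definition hoeffding w := \sum_i x i (w i) + (\sum_j quad j w) / 2.
Let dpart j w := x j (w j) + quad j w / 2.
Let tpart j w := x j (w j) + quad j w.

Lemma e_nonadj i j s t : ~~ adj i j -> e i j s t = 0.
Proof.
move=> /negbTE Nij; apply/eqP; rewrite -normr_le0.
by rewrite (le_trans (e_bounded _ _ _ _))// Nij.
Qed.

Lemma e_diag j s t : e j j s t = 0.
Proof. by rewrite e_nonadj// adj_irr. Qed.

Lemma e_le1 i j s t : `|e i j s t| <= 1.
Proof. by rewrite (le_trans (e_bounded _ _ _ _))//; case: adj. Qed.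

Lemma e_centered_upd i j w : i != j ->
  \sum_u e i j (upd w i u i) (upd w i u j) = 0.
Proof.
move=> ij; under eq_bigr => u _ do rewrite upd_same upd_other 1?eq_sym//.
exact: e_centered.
Qed.

(** Induction on [r]: the new term is centered in its own letter, which does not occur in the rest
    of the sum, so its product with any function of the rest averages to zero. *)
Lemma quad_moments j (r : seq I) : uniq r -> j \notin r ->
  let P w := \sum_(i <- r) e i j (w i) (w j) in
  avg (fun w => P w ^+ 2) <= (size r)%:R /\
  avg (fun w => P w ^+ 4) <= 4 * (size r)%:R ^+ 2.
Proof.
elim: r => [_ _|i r IH /= /andP[ir ur]].
  split=> /=; under eq_avg do rewrite big_nil expr0n /=;
    by rewrite avg_cst ?mulr_ge0// ?exprn_ge0.
rewrite inE negb_or eq_sym => /andP[ij jr].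
have [] := IH ur jr.
set P := fun w => \sum_(i <- r) e i j (w i) (w j) => P2 P4.
pose h w := e i j (w i) (w j).
have Pupd w u : P (upd w i u) = P w.
  apply: eq_big_seq => k kr.
  have ki : k != i by apply: contraNneq ir => <-.
  by rewrite !upd_other// eq_sym.
have hP (Q : R -> R) : avg (fun w => h w * Q (P w)) = 0.
  apply: (avg_centered T_gt0 (j := i)) => [w|w u]; last by rewrite Pupd.
  exact: e_centered_upd.
have h1 w : `|h w| <= 1 := e_le1 _ _ _ _.
have h2 w : h w ^+ 2 <= 1 by rewrite -real_normK ?num_real// exprn_ile1.
split.
  apply: (le_trans (y := avg (fun w => 1 + P w ^+ 2 + 2 * (h w * P w)))).
    apply: avg_le => w; rewrite big_cons -/(h w) -/(P w).
    by have := h2 w; nra.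
  rewrite !avgD avg_cst// avgZ (hP id) mulr0 addr0 -natr1.
  by rewrite addrC lerD2r.
(* Only the cross term linear in [h w] averages to zero; the one with its cube is absorbed into
   [2 + 2 * P w ^+ 2]. With k the size of [r], the increment is at most 3 + 8k, below 4(k+1)^2 -
   4k^2 = 8k + 4. *)
apply: (le_trans (y := avg (fun w => 3 + 8 * P w ^+ 2 + P w ^+ 4 +
    4 * (h w * (P w ^+ 3))))).
  apply: avg_le => w; rewrite big_cons -/(h w) -/(P w).
  have hh := h2 w; have hh0 := sqr_ge0 (h w).
  have -> : (h w + P w) ^+ 4 = (h w ^+ 2) ^+ 2 + 4 * h w ^+ 2 * (h w * P w) +
    6 * h w ^+ 2 * P w ^+ 2 + P w ^+ 4 + 4 * (h w * P w ^+ 3) by ring.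
  have e1 : (h w ^+ 2) ^+ 2 <= 1 by rewrite exprn_ile1.
  have e2 : 4 * h w ^+ 2 * (h w * P w) <= 2 + 2 * P w ^+ 2.
    have := sqr_ge0 (h w ^+ 3 - P w).
    have : (h w ^+ 2) ^+ 3 <= 1 by rewrite exprn_ile1.
    by nra.
  have e3 : 6 * h w ^+ 2 * P w ^+ 2 <= 6 * P w ^+ 2.
    by have := sqr_ge0 (P w); nra.
  by lra.
rewrite !avgD avg_cst// !avgZ (hP (fun z => z ^+ 3)) mulr0 addr0 -natr1.
by nra.
Qed.

Lemma quadE j w : quad j w = \sum_(i <- enum [pred i | adj i j]) e i j (w i) (w j).
Proof.
rewrite /quad big_enum /= [RHS]big_mkcond; apply: eq_bigr => i _ /=.
by case: ifPn => // /e_nonadj ->.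
Qed.

Lemma quad_moment2 j : avg (fun w => quad j w ^+ 2) <= D%:R.
Proof.
have [|+ _] := @quad_moments j _ (enum_uniq [pred i | adj i j]).
  by rewrite mem_enum inE adj_irr.
under eq_avg do rewrite -quadE.
by move=> /le_trans; apply; rewrite ler_nat -cardE adj_degree.
Qed.

Lemma quad_moment4 j : avg (fun w => quad j w ^+ 4) <= 4 * D%:R ^+ 2.
Proof.
have [|_] := @quad_moments j _ (enum_uniq [pred i | adj i j]).
  by rewrite mem_enum inE adj_irr.
under eq_avg do rewrite -quadE.
move=> /le_trans; apply; rewrite ler_wpM2l// lerXn2r ?nnegrE//.
by rewrite ler_nat -cardE adj_degree.
Qed.

Lemma dpart_centered j w : \sum_u dpart j (upd w j u) = 0.
Proof.
rewrite big_split /=; under eq_bigr do rewrite upd_same.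
rewrite x_centered add0r -mulr_suml exchange_big /= big1 ?mul0r// => i _.
have [->|ij] := eqVneq i j; first by rewrite big1// => u _; rewrite e_diag.
under eq_bigr do rewrite e_sym.
by rewrite e_centered_upd// eq_sym.
Qed.

Lemma hoeffding_dpart w : hoeffding w = \sum_j dpart j w.
Proof. by rewrite /hoeffding big_split /= mulr_suml. Qed.

(** The letter at [j] is absent from the right-hand side. A pair through [j] is counted in [quad j]
    and in the [quad] of its other end, so after halving it is removed exactly once. *)
Lemma hoeffding_tpartE j w : hoeffding w - tpart j w =
  \sum_(i | i != j) x i (w i) +
  (\sum_(k | k != j) \sum_(i | i != j) e i k (w i) (w k)) / 2.
Proof.
rewrite /hoeffding /tpart (bigD1 j) //= [\sum_k quad k w](bigD1 j)//=.
have -> : \sum_(k | k != j) quad k w =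
    quad j w + \sum_(k | k != j) \sum_(i | i != j) e i k (w i) (w k).
  under eq_bigr do rewrite /quad (bigD1 j)//=.
  rewrite big_split /=; congr (_ + _).
  rewrite /quad [RHS](bigD1 j)//= e_diag add0r.
  by apply: eq_bigr => k _; rewrite e_sym.
by lra.
Qed.

Lemma hoeffding_tpart_upd j w u :
  hoeffding (upd w j u) - tpart j (upd w j u) = hoeffding w - tpart j w.
Proof.
rewrite !hoeffding_tpartE; congr (_ + _ / _).
  by apply: eq_bigr => i ij; rewrite upd_other.
by apply: eq_bigr => k kj; apply: eq_bigr => i ij; rewrite !upd_other.
Qed.

Let qf w := \sum_j dpart j w * tpart j w.

(** S is the sum of the [dpart j], and [dpart j] is orthogonal to S - [tpart j], which does not
    involve the letter at [j]. *)
Lemma avg_hoeffding2 : avg (fun w => hoeffding w ^+ 2) = avg qf.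
Proof.
rewrite avg_sum.
transitivity (avg (fun w => \sum_j dpart j w * hoeffding w)).
  by apply: eq_avg => w; rewrite -mulr_suml -hoeffding_dpart expr2.
rewrite avg_sum; apply: eq_bigr => j _; apply/eqP; rewrite -subr_eq0 -avgB.
under eq_avg do rewrite -mulrBr.
apply/eqP/(avg_centered T_gt0 (j := j)) => [w|w u].
  exact: dpart_centered.
exact: hoeffding_tpart_upd.
Qed.

Let A4 := \sum_j a j ^+ 4.
Let A2 := \sum_j a j ^+ 2.

Lemma a_ge0 j : 0 <= a j.
Proof.
have [t _] : exists t : T, t \in T by apply/card_gt0P.
exact: le_trans (x_bounded j t).
Qed.

Lemma x_sqr_le j t : x j t ^+ 2 <= a j ^+ 2.
Proof. by rewrite -real_normK ?num_real// lerXn2r ?nnegrE ?a_ge0. Qed.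

(** Write X and Q for the linear and quadratic terms at [j]. Expanding (X + Q/2)(X + Q) gives X^2 +
    (3/2) X Q + Q^2/2, and each of the three families is a sum of local terms. The squares X^2
    depend on one letter each, so they cost no factor [m]. *)
Lemma var_qf : avg (fun w => (qf w - avg qf) ^+ 2) <=
  3 * (A4 + 9 / 4 * m%:R * D%:R * A2 + m%:R * D%:R ^+ 2 * #|I|%:R).
Proof.
pose YA j w := x j (w j) ^+ 2.
pose YB j w := 3 / 2 * (x j (w j) * quad j w).
pose YC j w := quad j w ^+ 2 / 2.
have winx j w w' : {in window j, forall i, w i = w' i} -> w j = w' j.
  by move=> ww'; apply: ww'; rewrite !inE eqxx.
have winq j w w' : {in window j, forall i, w i = w' i} -> quad j w = quad j w'.
  move=> ww'; rewrite !quadE; apply: eq_big_seq => i.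
  by rewrite mem_enum inE => ij; rewrite !ww'// !inE ?ij ?orbT ?eqxx.
have VA : avg (fun w => (\sum_j (YA j w - avg (YA j))) ^+ 2) <= A4.
  have H1 j : depends_on [set j] (YA j).
    by move=> w w' ww'; rewrite /YA (ww' j) ?inE.
  have H2 (j : I) : (#|[pred k | ~~ [disjoint [set j] & [set k]]]| <= 1)%N.
    rewrite -(card1 j); apply: subset_leq_card; apply/fintype.subsetP => k.
    by rewrite !inE disjoints1 inE negbK eq_sym.
  apply: (le_trans (avg_sqr_local_sum T_gt0 H1 H2)).
  rewrite mul1r; apply: ler_sum => j _.
  rewrite -[leRHS](avg_cst I T_gt0); apply: avg_le => w; rewrite /YA.
  by rewrite -exprM (exprM _ 2 2) (exprM _ 2 2) lerXn2r ?nnegrE ?sqr_ge0 ?x_sqr_le.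
have VB : avg (fun w => (\sum_j (YB j w - avg (YB j))) ^+ 2) <=
    9 / 4 * m%:R * D%:R * A2.
  have H1 j : depends_on (window j) (YB j).
    by move=> w w' ww'; rewrite /YB (winx j w w')// (winq j w w').
  apply: (le_trans (avg_sqr_local_sum T_gt0 H1 window_degree)).
  have -> : 9 / 4 * m%:R * D%:R * A2 = m%:R * \sum_j 9 / 4 * (a j ^+ 2 * D%:R).
    by rewrite -mulr_sumr -mulr_suml -/A2; ring.
  rewrite ler_wpM2l//; apply: ler_sum => j _.
  apply: (le_trans (y := avg (fun w => 9 / 4 * a j ^+ 2 * quad j w ^+ 2))).
    apply: avg_le => w; rewrite /YB.
    have := x_sqr_le j (w j); have := sqr_ge0 (quad j w).
    have -> : (3 / 2 * (x j (w j) * quad j w)) ^+ 2 =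
      9 / 4 * x j (w j) ^+ 2 * quad j w ^+ 2 by field.
    by move=> q0 xa; rewrite ler_wpM2r// ler_wpM2l.
  have := ler_wpM2l (sqr_ge0 (a j)) (quad_moment2 j).
  by rewrite avgZ; lra.
have VC : avg (fun w => (\sum_j (YC j w - avg (YC j))) ^+ 2) <=
    m%:R * D%:R ^+ 2 * #|I|%:R.
  have H1 j : depends_on (window j) (YC j).
    by move=> w w' ww'; rewrite /YC (winq j w w').
  apply: (le_trans (avg_sqr_local_sum T_gt0 H1 window_degree)).
  rewrite -mulrA ler_wpM2l// mulr_natr -sumr_const; apply: ler_sum => j _.
  have -> : avg (fun w => YC j w ^+ 2) = 1 / 4 * avg (fun w => quad j w ^+ 4).
    by rewrite -avgZ; apply: eq_avg => w; rewrite /YC; field.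
  by have := quad_moment4 j; lra.
have qfE w : qf w = \sum_j YA j w + \sum_j YB j w + \sum_j YC j w.
  rewrite -!big_split; apply: eq_bigr => j _.
  by rewrite /= /YA /YB /YC /dpart /tpart; field.
have avgqf : avg qf = \sum_j avg (YA j) + \sum_j avg (YB j) + \sum_j avg (YC j).
  by rewrite -!avg_sum -!avgD; apply: eq_avg.
set sA := fun w => \sum_j (YA j w - avg (YA j)) in VA.
set sB := fun w => \sum_j (YB j w - avg (YB j)) in VB.
set sC := fun w => \sum_j (YC j w - avg (YC j)) in VC.
apply: (le_trans (y := avg (fun w => 3 * (sA w ^+ 2 + sB w ^+ 2 + sC w ^+ 2)))).
  apply: avg_le => w.
  have -> : qf w - avg qf = sA w + sB w + sC w.
    by rewrite qfE avgqf /sA /sB /sC !sumrB; lra.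
  have := sqr_ge0 (sA w - sB w); have := sqr_ge0 (sA w - sC w).
  by have := sqr_ge0 (sB w - sC w); nra.
by rewrite avgZ !avgD ler_wpM2l// !lerD.
Qed.

(** Together with [tpart_moment4], this controls the Taylor remainders, which are of order |D_j|
    T_j^2. *)
Lemma dpart_moment2 : \sum_j avg (fun w => dpart j w ^+ 2) <=
  2 * A2 + D%:R * #|I|%:R / 2.
Proof.
have -> : 2 * A2 + D%:R * #|I|%:R / 2 = \sum_j (2 * a j ^+ 2 + D%:R / 2) :> R.
  by rewrite big_split /= sumr_const -mulr_sumr -/A2 -[X in _ = _ + X]mulr_natr; lra.
apply: ler_sum => j _.
apply: (le_trans (y := avg (fun w => 2 * a j ^+ 2 + 1 / 2 * quad j w ^+ 2))).
  apply: avg_le => w; rewrite /dpart; have := x_sqr_le j (w j).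
  by have := sqr_ge0 (x j (w j) - quad j w / 2); nra.
by rewrite avgD avg_cst// avgZ; have := quad_moment2 j; lra.
Qed.

Lemma tpart_moment4 : \sum_j avg (fun w => tpart j w ^+ 4) <=
  8 * (A4 + 4 * D%:R ^+ 2 * #|I|%:R).
Proof.
have -> : 8 * (A4 + 4 * D%:R ^+ 2 * #|I|%:R) =
    \sum_j (8 * a j ^+ 4 + 32 * D%:R ^+ 2) :> R.
  by rewrite big_split /= sumr_const -mulr_sumr -/A4 -[X in _ = _ + X]mulr_natr; lra.
apply: ler_sum => j _.
apply: (le_trans (y := avg (fun w => 8 * a j ^+ 4 + 8 * quad j w ^+ 4))).
  apply: avg_le => w; rewrite /tpart.
  have : x j (w j) ^+ 4 <= a j ^+ 4.
    by rewrite (exprM _ 2 2) (exprM _ 2 2) lerXn2r ?nnegrE ?sqr_ge0 ?x_sqr_le.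
  set X := x j (w j); set Y := quad j w.
  have : (X + Y) ^+ 2 <= 2 * (X ^+ 2 + Y ^+ 2) by have := sqr_ge0 (X - Y); nra.
  move=> h; have : (X + Y) ^+ 4 <= 4 * (X ^+ 2 + Y ^+ 2) ^+ 2.
    rewrite (_ : 4 * _ = (2 * (X ^+ 2 + Y ^+ 2)) ^+ 2); last by ring.
    by rewrite (exprM _ 2 2) lerXn2r ?nnegrE ?sqr_ge0// mulr_ge0// addr_ge0 ?sqr_ge0.
  by have := sqr_ge0 (X ^+ 2 - Y ^+ 2); nra.
by rewrite avgD avg_cst// avgZ; have := quad_moment4 j; lra.
Qed.

Variables (F F' : R -> R) (L1 L2 lam1 lam2 : R).
Hypothesis F'_bounded : forall s, `|F' s| <= L1.
Hypothesis F_taylor : forall s t, `|F s - F (s - t) - t * F' s| <= L2 * t ^+ 2.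
Hypothesis lam1_gt0 : 0 < lam1.
Hypothesis lam2_gt0 : 0 < lam2.

(* AM-GM with a free weight replaces Cauchy-Schwarz. *)
Lemma amgm (lam b c : R) : 0 < lam -> b * c <= (lam * b ^+ 2 + c ^+ 2 / lam) / 2.
Proof.
move=> l0; rewrite -subr_ge0.
have -> : (lam * b ^+ 2 + c ^+ 2 / lam) / 2 - b * c = (lam * b - c) ^+ 2 / lam / 2.
  by field; rewrite gt_eqF.
by rewrite !divr_ge0 ?sqr_ge0 ?ltW.
Qed.

(** Since D_j is orthogonal to F(S - T_j), E[S F(S)] is the sum of the E[D_j (F(S) - F(S - T_j))].
    Taylor's formula replaces the difference by T_j F'(S). The first error term comes from replacing
    the sum of the D_j T_j by its mean, the second from the Taylor remainders; the weights are
    chosen later. *)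
Lemma stein_words :
  `|avg (fun w => hoeffding w * F (hoeffding w)) -
    avg (fun w => hoeffding w ^+ 2) * avg (fun w => F' (hoeffding w))| <=
  L1 / 2 * (lam1 + 3 * (A4 + 9 / 4 * m%:R * D%:R * A2 +
                        m%:R * D%:R ^+ 2 * #|I|%:R) / lam1) +
  L2 / 2 * (lam2 * (2 * A2 + D%:R * #|I|%:R / 2) +
            8 * (A4 + 4 * D%:R ^+ 2 * #|I|%:R) / lam2).
Proof.
rewrite avg_hoeffding2; set S := hoeffding.
have L1_ge0 : 0 <= L1 by rewrite (le_trans _ (F'_bounded 0)).
have L2_ge0 : 0 <= L2 by have := F_taylor 0 1; rewrite expr1n mulr1; exact: le_trans.
pose rem w := \sum_j dpart j w *
  (F (S w) - F (S w - tpart j w) - tpart j w * F' (S w)).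
have -> : avg (fun w => S w * F (S w)) =
    avg (fun w => qf w * F' (S w)) + avg rem.
  rewrite -avgD; apply/eqP; rewrite -subr_eq0 -avgB; apply/eqP.
  transitivity (\sum_j avg (fun w => dpart j w * F (S w - tpart j w))).
    rewrite -avg_sum; apply: eq_avg => w; rewrite /rem {1}/S hoeffding_dpart.
    rewrite /qf !mulr_suml -big_split -sumrB; apply: eq_bigr => j _ /=.
    by ring.
  rewrite big1// => j _; apply: (avg_centered T_gt0 (j := j)) => [w|w u].
    exact: dpart_centered.
  by rewrite hoeffding_tpart_upd.
rewrite addrAC (le_trans (ler_normD _ _))// lerD//.
  have -> : avg (fun w => qf w * F' (S w)) - avg qf * avg (F' \o S) =
      avg (fun w => (qf w - avg qf) * F' (S w)).
    by rewrite -avgZ -avgB; apply: eq_avg => w /=; rewrite mulrBl.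
  apply: (le_trans (ler_norm_avg T_gt0 _)).
  apply: (le_trans (y := avg (fun w =>
      L1 / 2 * (lam1 + (qf w - avg qf) ^+ 2 / lam1)))).
    apply: avg_le => w; rewrite normrM mulrC.
    apply: (le_trans (y := L1 * `|qf w - avg qf|)); first by rewrite ler_wpM2r.
    rewrite -mulrA ler_wpM2l//.
    have := @amgm lam1 1 `|qf w - avg qf| lam1_gt0.
    by rewrite expr1n mulr1 mul1r real_normK ?num_real// => /le_trans; apply; lra.
  rewrite avgZ avgD avg_cst// ler_wpM2l ?divr_ge0// lerD2l.
  under eq_avg do rewrite mulrC.
  by rewrite avgZ mulrC ler_wpM2r ?invr_ge0 ?(ltW lam1_gt0)// var_qf.
apply: (le_trans (ler_norm_avg T_gt0 _)).
apply: (le_trans (y := avg (fun w => L2 / 2 * (lam2 * (\sum_j dpart j w ^+ 2) +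
    (\sum_j tpart j w ^+ 4) / lam2)))).
  apply: avg_le => w; apply: (le_trans (ler_norm_sum _ _ _)).
  rewrite mulr_sumr mulr_suml -big_split mulr_sumr /=; apply: ler_sum => j _.
  rewrite normrM; apply: (le_trans (y := `|dpart j w| * (L2 * tpart j w ^+ 2))).
    by rewrite ler_wpM2l.
  rewrite mulrCA -mulrA ler_wpM2l//.
  have := @amgm lam2 `|dpart j w| (tpart j w ^+ 2) lam2_gt0.
  by rewrite real_normK ?num_real// -exprM => /le_trans; apply; lra.
rewrite avgZ avgD avgZ ler_wpM2l ?divr_ge0// lerD//.
  by rewrite ler_wpM2l ?(ltW lam2_gt0)// avg_sum dpart_moment2.
under eq_avg do rewrite mulrC.
by rewrite avgZ mulrC ler_wpM2r ?invr_ge0 ?(ltW lam2_gt0)// avg_sum tpart_moment4.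
Qed.

(** Distinct terms are orthogonal, as their product is centered in a letter that occurs in only one
    of them; only the squares remain. *)
Lemma avg_hoeffding2E : avg (fun w => hoeffding w ^+ 2) =
  \sum_j (\sum_t x j t ^+ 2) / #|T|%:R +
  (\sum_j \sum_i (\sum_s \sum_t e i j s t ^+ 2)) / (2 * #|T|%:R ^+ 2).
Proof.
rewrite avg_hoeffding2 avg_sum mulr_suml -big_split /=; apply: eq_bigr => j _.
transitivity (avg (fun w => x j (w j) ^+ 2 +
    3 / 2 * (x j (w j) * quad j w) + 1 / 2 * quad j w ^+ 2)).
  by apply: eq_avg => w; rewrite /dpart /tpart; field.
rewrite !avgD !avgZ (avg_letter T_gt0 j (fun t => x j t ^+ 2)).
have -> : avg (fun w => x j (w j) * quad j w) = 0.
  under eq_avg do rewrite mulr_sumr.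
  rewrite avg_sum big1// => i _; have [->|ij] := eqVneq i j.
    by under eq_avg do rewrite e_diag mulr0; rewrite avg_cst.
  under eq_avg do rewrite mulrC.
  apply: (avg_centered T_gt0 (j := i)) => [w|w u].
    exact: e_centered_upd.
  by rewrite upd_other// eq_sym.
have -> : avg (fun w => quad j w ^+ 2) =
    (\sum_i \sum_s \sum_t e i j s t ^+ 2) / #|T|%:R ^+ 2.
  transitivity (avg (fun w => \sum_i \sum_k
      e i j (w i) (w j) * e k j (w k) (w j))).
    by apply: eq_avg => w; rewrite expr2 big_distrlr.
  rewrite avg_sum mulr_suml; apply: eq_bigr => i _; rewrite avg_sum.
  have [->|ij] := eqVneq i j.
    rewrite big1 => [|k _].
      rewrite big1 ?mul0r// => s _; rewrite big1// => t _.
      by rewrite e_diag expr0n.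
    by under eq_avg do rewrite e_diag mul0r; rewrite avg_cst.
  rewrite (bigD1 i)//= big1 => [|k ki].
    rewrite addr0 -(avg_two_letters T_gt0 (fun s t => e i j s t ^+ 2) ij).
    by apply: eq_avg => w; rewrite expr2.
  apply: (avg_centered T_gt0 (j := i)) => [w|w u].
    exact: e_centered_upd.
  by rewrite !upd_other// eq_sym.
rewrite mulr0 addr0; congr (_ + _).
by rewrite div1r mulrCA -invfM.
Qed.

End SteinWords.

(** * Descents of words *)

Section DescentsOfWords.
Variables (R : realFieldType) (n d : nat).

Definition close_pair (i j : nat) := (i < j <= i + d)%N.

(** Equal letters form no descent. On the values of a permutation this count is convertible with
    [d_descents]. *)
Definition word_descents (w : 'I_n -> nat) : nat :=
  #|[pred ij : 'I_n * 'I_n |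
      [&& (ij.1 < ij.2)%N, (ij.2 <= ij.1 + d)%N & (w ij.2 < w ij.1)%N]]|.

Lemma word_descentsE w : (word_descents w)%:R =
  \sum_(i < n) \sum_(j < n) (close_pair i j)%:R * (w j < w i)%N%:R :> R.
Proof.
rewrite /word_descents -sum1_card natr_sum big_mkcond.
rewrite pair_big /=; apply: eq_bigr => -[i j] _ /=.
rewrite -natrM mulnb /close_pair.
by rewrite inE /= andbA; case: ifP.
Qed.

Lemma card_ord_itv a b :
  (\sum_(k < n) ((a <= k) && (k < b)) = minn b n - a)%N.
Proof.
elim: n => [|m IH]; first by rewrite big_ord0; lia.
by rewrite big_ord_recr /= IH; case: (leqP a m); case: (ltnP m b) => /=; lia.
Qed.

Lemma close_pairs_right (i : 'I_n) :
  (\sum_(k < n) close_pair i k = minn (i + d).+1 n - i.+1)%N.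
Proof. by rewrite -card_ord_itv; apply: eq_bigr => k _; rewrite /close_pair ltnS. Qed.

Lemma close_pairs_left (i : 'I_n) :
  (\sum_(k < n) close_pair k i = i - (i - d))%N.
Proof.
have := card_ord_itv (i - d) i.
rewrite (minn_idPl (ltnW (ltn_ord i))) => <-.
by apply: eq_bigr => k _; rewrite /close_pair andbC leq_subLR addnC.
Qed.

(** A close pair i < j contributes [lin] of the letter at i minus [lin] of the letter at j, so a
    position counts its right neighbours positively and its left neighbours negatively. *)
Definition edge_coef (i : 'I_n) : R :=
  \sum_(k < n) (close_pair i k)%:R - \sum_(k < n) (close_pair k i)%:R.

Lemma edge_coefE i :
  edge_coef i = (minn (i + d).+1 n - i.+1)%:R - (i - (i - d))%:R.
Proof. by rewrite /edge_coef -!natr_sum close_pairs_right close_pairs_left. Qed.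

Definition npairs : R := \sum_(i < n) \sum_(j < n) (close_pair i j)%:R.

Hypothesis dn : (2 * d <= n)%N.

Definition edge_bound (i : 'I_n) : R := ((i < d) || (n <= i + d))%N%:R * d%:R.

(** At distance at least [d] from both ends there are [d] close positions on either side, and the
    two counts cancel. *)
Lemma edge_coef_le i : `|edge_coef i| <= edge_bound i.
Proof.
rewrite edge_coefE /edge_bound; have ni := ltn_ord i.
have [edge|mid] := boolP ((i < d) || (n <= i + d))%N; last first.
  rewrite mul0r normr_le0 subr_eq0; apply/eqP; congr _%:R; lia.
rewrite mul1r; set r := (minn _ _ - _)%N; set l := (i - (i - d))%N.
have rd : (r <= d)%N by rewrite /r; lia.
have ld : (l <= d)%N by rewrite /l; lia.
move: rd ld; rewrite -!(ler_nat R) ler_norml => rd ld.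
by have := ler0n R r; have := ler0n R l; lra.
Qed.

Lemma card_edges : (\sum_(i < n) ((i < d) || (n <= i + d)) <= 2 * d)%N.
Proof.
apply: (@leq_trans (\sum_(i < n) ((0 <= i) && (i < d)) +
    \sum_(i < n) ((n - d <= i) && (i < n)))%N).
  rewrite -big_split /=; apply: leq_sum => i _.
  by rewrite ltn_ord andbT leq_subLR (addnC d); case: (i < d)%N; case: (n <= i + d)%N.
by rewrite !card_ord_itv; lia.
Qed.

(** The exponent is positive, so that powers of the edge indicator are the indicator itself. The
    cases used are the squares and the fourth powers. *)
Lemma edge_bound_sum k : \sum_(i < n) edge_bound i ^+ k.+1 <= 2 * d%:R ^+ k.+2.
Proof.
have E (i : 'I_n) : edge_bound i ^+ k.+1 =
    ((i < d) || (n <= i + d))%N%:R * d%:R ^+ k.+1.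
  by rewrite /edge_bound exprMn; case: (_ || _); rewrite ?expr1n ?expr0n.
under eq_bigr do rewrite E.
rewrite -mulr_suml [d%:R ^+ k.+2]exprS mulrA ler_wpM2r ?exprn_ge0//.
by rewrite -natr_sum -natrM ler_nat card_edges.
Qed.

Lemma sum_sqr_down m : (m%:R ^+ 3 / 3 <= \sum_(i < m) (m - i)%:R ^+ 2 :> R).
Proof.
elim: m => [|m IH]; first by rewrite big_ord0 expr0n mul0r.
rewrite big_ord_recl subn0 /=.
have -> : \sum_(i < m) (m.+1 - bump 0 i)%:R ^+ 2 =
    \sum_(i < m) (m - i)%:R ^+ 2 :> R.
  by apply: eq_bigr => i _; rewrite /bump /= add1n subSS.
by move: IH; rewrite -[m.+1%:R]natr1; have := ler0n R m; nra.
Qed.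

(** The left end suffices: for i < d there are [d] close positions to the right, because 2d <= n,
    and i to the left, so the coefficient is d - i. *)
Lemma edge_coef_sum : d%:R ^+ 3 / 3 <= \sum_(i < n) edge_coef i ^+ 2.
Proof.
apply: (le_trans (sum_sqr_down d)).
have dn' : (d <= n)%N by lia.
rewrite (big_ord_widen n (fun i => (d - i)%:R ^+ 2 : R))// big_mkcond.
apply: ler_sum => i _; case: ifP => id; last exact: sqr_ge0.
rewrite edge_coefE (_ : minn _ _ - _ = d)%N; last by lia.
by rewrite (_ : i - (i - d) = i)%N -?natrB//; lia.
Qed.

(** Each of the first n - d positions has [d] close positions to its right, and n - d >= n/2. *)
Lemma npairs_ge : n%:R * d%:R / 2 <= npairs.
Proof.
have : (n * d <= 2 * \sum_(i < n) \sum_(j < n) close_pair i j)%N.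
  apply: (@leq_trans (2 * ((n - d) * d))); first by nia.
  rewrite leq_mul2l /=; apply: (@leq_trans (\sum_(i < n - d) d)%N).
    by rewrite sum_nat_const card_ord.
  rewrite (big_ord_widen n (fun=> d)); last by lia.
  rewrite big_mkcond; apply: leq_sum => i _; case: ifP => // ni.
  by rewrite close_pairs_right; lia.
rewrite -(ler_nat R) !natrM natr_sum.
under eq_bigr do rewrite natr_sum.
by rewrite -/npairs; lra.
Qed.

Definition close (i j : 'I_n) := close_pair i j || close_pair j i.

Lemma close_irr : irreflexive close.
Proof. by move=> i; rewrite /close /close_pair ltnn. Qed.

Lemma close_degree j : (#|[pred i | close i j]| <= 2 * d)%N.
Proof.
rewrite -sum1_card big_mkcond /=.
apply: (@leq_trans (\sum_(k < n) close_pair j k + \sum_(k < n) close_pair k j)%N).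
  rewrite -big_split /=; apply: leq_sum => i _; rewrite inE /close.
  by do 2 case: (close_pair _ _).
by rewrite close_pairs_right close_pairs_left; lia.
Qed.

(** Meeting windows have centres at distance at most 2d, which leaves 4d + 1 <= 5d choices. *)
Lemma close_window_degree (j : 'I_n) : (0 < d)%N ->
  (#|[pred k | ~~ [disjoint j |: [set i | close i j] & k |: [set i | close i k]]]|
    <= 5 * d)%N.
Proof.
move=> d0; rewrite -sum1_card big_mkcond /=.
apply: (@leq_trans (\sum_(k < n)
    ((j - 2 * d <= k) && (k < j + (2 * d).+1)))%N); last first.
  by rewrite card_ord_itv; lia.
apply: leq_sum => k _; rewrite inE; case: ifPn => // /pred0Pn[i] /=.
rewrite !inE -!val_eqE /close /close_pair /= => H.
by rewrite (_ : _ && _ = true)//; move: H; lia.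
Qed.

End DescentsOfWords.

(** * Hoeffding decomposition of the comparison of two uniform letters *)

Section Kernel.
Variables (R : realFieldType) (M : nat).

Lemma sum_ordR m : \sum_(t < m) t%:R = m%:R * (m%:R - 1) / 2 :> R.
Proof.
elim: m => [|m IH]; first by rewrite big_ord0 mul0r mul0r.
by rewrite big_ord_recr /= IH -[m.+1%:R]natr1; field.
Qed.

Lemma sum_sqr_ordR m :
  \sum_(t < m) t%:R ^+ 2 = m%:R * (m%:R - 1) * (2 * m%:R - 1) / 6 :> R.
Proof.
elim: m => [|m IH]; first by rewrite big_ord0 !mul0r.
by rewrite big_ord_recr /= IH -[m.+1%:R]natr1; field.
Qed.

Let T := 'I_M.+1.
Let N : R := M.+1%:R.
Let N_neq0 : N != 0. Proof. by rewrite pnatr_eq0. Qed.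

(** Both the probability that t < s for two independent uniform letters and the mean of t/N. *)
Definition letter_mean : R := (N - 1) / (2 * N).
(** Given s, the event t < s has probability s/N, so its centered projection on s is [lin s];
    likewise its projection on t is [- lin t]. *)
Definition lin (t : T) : R := t%:R / N - letter_mean.
(* The degenerate part of the Hoeffding decomposition of [t < s]. *)
Definition ker (s t : T) : R := (t < s)%N%:R - letter_mean - (lin s - lin t).

Lemma sum_lin : \sum_t lin t = 0.
Proof.
rewrite sumrB -mulr_suml sum_ordR sumr_const card_ord -[_ *+ M.+1]mulr_natr -/N.
by rewrite /letter_mean; field.
Qed.

Lemma sum_below (s : T) (phi : nat -> R) :
  \sum_(t : T) (t < s)%N%:R * phi t = \sum_(t < s) phi t.
Proof.
rewrite (big_ord_widen M.+1 phi) 1?ltnW// [RHS]big_mkcond.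
by apply: eq_bigr => t _; case: ifP => _; rewrite ?mul1r ?mul0r.
Qed.

Lemma sum_ltr (s : T) : \sum_(t : T) (t < s)%N%:R = s%:R :> R.
Proof.
under eq_bigr do rewrite -[_%:R]mulr1.
by rewrite (sum_below s (fun=> 1)) sumr_const card_ord.
Qed.

Lemma sum_ltl (t : T) : \sum_(s : T) (t < s)%N%:R = N - 1 - t%:R :> R.
Proof.
have : \sum_(s : T) ((t < s)%N%:R + (s < t)%N%:R + (s == t)%:R) = N :> R.
  transitivity (\sum_(s : T) 1 : R); last by rewrite sumr_const card_ord.
  apply: eq_bigr => s _; rewrite -val_eqE /=.
  by case: ltngtP => _ /=; rewrite ?addr0 ?add0r.
rewrite !big_split /= sum_ltr [X in _ + X](bigD1 t)//= eqxx.
rewrite [X in _ + (_ + X)]big1 => [|s /negbTE -> //].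
by rewrite addr0 => <-; rewrite !addrK.
Qed.

Lemma sum_ker_r (s : T) : \sum_t ker s t = 0.
Proof.
rewrite /ker sumrB sumrB [X in _ - X]sumrB sum_lin subr0 sum_ltr !sumr_const card_ord.
rewrite -[letter_mean *+ _]mulr_natr -[lin _ *+ _]mulr_natr -/N.
by rewrite /lin /letter_mean; field.
Qed.

Lemma sum_ker_l (t : T) : \sum_s ker s t = 0.
Proof.
rewrite /ker sumrB sumrB [X in _ - X]sumrB sum_lin sub0r opprK.
rewrite sum_ltl !sumr_const card_ord.
rewrite -[letter_mean *+ _]mulr_natr -[lin _ *+ _]mulr_natr -/N.
by rewrite /lin /letter_mean; field.
Qed.

Lemma letter_bounds (t : T) : [/\ 0 <= t%:R / N, t%:R / N <= 1 - N^-1 & 0 < N^-1 <= 1].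
Proof.
have N0 : 0 < N by rewrite ltr0n.
split; first by rewrite divr_ge0.
  rewrite -[leRHS](mulfK N_neq0) ler_pM2r ?invr_gt0// mulrBl mulVf// mul1r.
  by rewrite /N -natr1 addrK ler_nat -ltnS.
by rewrite invr_gt0 N0 invf_le1// ler1n.
Qed.

Lemma letter_meanE : letter_mean = (1 - N^-1) / 2.
Proof. by rewrite /letter_mean; field. Qed.

Lemma lin_le1 t : `|lin t| <= 1.
Proof.
rewrite /lin letter_meanE ler_norml; case: (letter_bounds t).
by move: (t%:R / N) (N^-1) => u i u0 u1 /andP[i0 i1]; lra.
Qed.

Lemma ker_le1 s t : `|ker s t| <= 1.
Proof.
rewrite /ker /lin letter_meanE ler_norml.
have mono (a b : T) : (a <= b)%N -> a%:R / N <= b%:R / N.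
  by move=> ab; rewrite ler_wpM2r ?invr_ge0 ?ler0n// ler_nat.
(* The bounds on the fractions alone are too weak: their order has to agree with the value of the
   indicator. *)
have st : if (t < s)%N then t%:R / N <= s%:R / N else s%:R / N <= t%:R / N.
  by case: ltnP => [/ltnW|]; exact: mono.
move: (letter_bounds s) (letter_bounds t) st.
move: (s%:R / N) (t%:R / N) (N^-1) => u v i [u0 u1 /andP[i0 i1]] [v0 v1 _].
by case: (t < s)%N => uv; rewrite ?mulr1n ?mulr0n; lra.
Qed.

Lemma sum_lin2 : \sum_t lin t ^+ 2 = (N ^+ 2 - 1) / (12 * N).
Proof.
transitivity (\sum_(t : T) (t%:R ^+ 2 / N ^+ 2 - 2 * letter_mean / N * t%:R +
    letter_mean ^+ 2)).
  by apply: eq_bigr => t _; rewrite /lin; field.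
rewrite big_split sumrB /= -mulr_suml -mulr_sumr sum_sqr_ordR sum_ordR.
rewrite sumr_const card_ord -[_ *+ M.+1]mulr_natr -/N.
by rewrite /letter_mean; field.
Qed.

Lemma sum_ker2 : \sum_s \sum_t ker s t ^+ 2 = (N ^+ 2 - 1) / 12.
Proof.
transitivity (\sum_(s : T) \sum_(t : T) (t < s)%N%:R * ker s t).
  (* [ker] is orthogonal to functions of a single letter. *)
  apply/eqP; rewrite -subr_eq0 -sumrB; apply/eqP.
  transitivity (\sum_s \sum_t (lin t * ker s t - (letter_mean + lin s) * ker s t)).
    apply: eq_bigr => s _; rewrite -sumrB; apply: eq_bigr => t _.
    have -> : (t < s)%N%:R = ker s t + letter_mean + (lin s - lin t) :> R.
      by rewrite /ker; ring.
    by ring.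
  under eq_bigr do rewrite sumrB -mulr_sumr sum_ker_r mulr0 subr0.
  rewrite exchange_big big1//= => t _.
  by rewrite -mulr_sumr sum_ker_l mulr0.
(* The indicator restricts the inner sum to t < s, where [ker s t] is affine in t. *)
transitivity (\sum_(s : T) (s%:R * N - s%:R ^+ 2) / (2 * N)).
  apply: eq_bigr => s _.
  transitivity (\sum_(t : T) (t < s)%N%:R * (1 - letter_mean - s%:R / N + t%:R / N)).
    by apply: eq_bigr => t _; rewrite /ker /lin; case: (t < s)%N;
      rewrite ?mulr0n ?mul0r// mulr1n !mul1r; move: (s%:R / N) (t%:R / N) => u v; ring.
  rewrite (sum_below s (fun t => 1 - letter_mean - s%:R / N + t%:R / N)).
  rewrite big_split /= -mulr_suml sum_ordR sumr_const card_ord.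
  by rewrite -[_ *+ s]mulr_natr /letter_mean; field.
rewrite -mulr_suml sumrB -mulr_suml sum_ordR sum_sqr_ordR -/N.
by field.
Qed.

End Kernel.

(** * Stein bound for the descents of a random word *)

Section WordStein.
Variables (R : realFieldType) (n d M : nat).
Hypothesis d_gt0 : (0 < d)%N.
Hypothesis dn : (2 * d <= n)%N.
Hypothesis M_gt0 : (0 < M)%N.
Let T := 'I_M.+1.

Definition desR (w : {ffun 'I_n -> T}) : R := (word_descents d (fun i => w i))%:R.

Let x (i : 'I_n) (t : T) : R := edge_coef R d i * lin R t.
(** Symmetrized over the order of the positions; at most one of the two summands is nonzero. *)
Let e (i j : 'I_n) (s t : T) : R :=
  (close_pair d i j)%:R * ker R s t + (close_pair d j i)%:R * ker R t s.

Let x0 i : \sum_t x i t = 0.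
Proof. by rewrite -mulr_sumr sum_lin mulr0. Qed.

Let xb i t : `|x i t| <= edge_bound R d i.
Proof.
rewrite normrM -[leRHS]mulr1 ler_pM ?lin_le1//.
exact: edge_coef_le.
Qed.

Let e_sym i j s t : e i j s t = e j i t s.
Proof. by rewrite /e addrC. Qed.

Let e0 i j t : \sum_s e i j s t = 0.
Proof. by rewrite big_split /= -!mulr_sumr sum_ker_l sum_ker_r !mulr0 addr0. Qed.

Lemma close_pair_asym i j : close_pair d i j -> close_pair d j i = false.
Proof. by rewrite /close_pair => ?; apply/negP; lia. Qed.

Let eb i j s t : `|e i j s t| <= (close d i j)%:R.
Proof.
rewrite /e /close; have [ij|ij] := boolP (close_pair d i j).
  by rewrite close_pair_asym// mul0r addr0 mul1r ker_le1.
rewrite mul0r add0r /=; case: (close_pair d j i); rewrite ?mul0r ?normr0//.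
by rewrite mul1r ker_le1.
Qed.

Let T_gt0 : (0 < #|T|)%N. Proof. by rewrite card_ord. Qed.

(** The indicator of a descent is [ker] plus the two [lin] terms plus [letter_mean]. Summed over
    close pairs, the [lin] terms regroup by position into [edge_coef]. *)
Lemma desR_hoeffding w :
  desR w = hoeffding x e w + npairs R n d * letter_mean R M.
Proof.
rewrite /desR word_descentsE.
transitivity (\sum_(i < n) \sum_(j < n) (close_pair d i j)%:R *
    (ker R (w i) (w j) + lin R (w i) - lin R (w j) + letter_mean R M)).
  by apply: eq_bigr => i _; apply: eq_bigr => j _; rewrite /ker; congr (_ * _); ring.
have -> : hoeffding x e w = \sum_(i < n) \sum_(j < n) (close_pair d i j)%:R *
    (ker R (w i) (w j) + lin R (w i) - lin R (w j)).
  transitivity (\sum_(i < n) \sum_(j < n) (close_pair d i j)%:R * ker R (w i) (w j)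
    + (\sum_(i < n) \sum_(j < n) (close_pair d i j)%:R * lin R (w i)
    - \sum_(i < n) \sum_(j < n) (close_pair d i j)%:R * lin R (w j))).
    rewrite /hoeffding addrC; congr (_ + _).
      have -> : \sum_j quad e j w =
          2 * \sum_(i < n) \sum_(j < n) (close_pair d i j)%:R * ker R (w i) (w j).
        under eq_bigr do rewrite /quad big_split /=.
        rewrite big_split /= exchange_big /=; lra.
      by lra.
    rewrite [X in _ - X]exchange_big /= -sumrB; apply: eq_bigr => i _.
    by rewrite /x /edge_coef mulrBl !mulr_suml.
  rewrite -sumrB -big_split; apply: eq_bigr => i _ /=.
  rewrite -sumrB -big_split; apply: eq_bigr => j _ /=.
  by ring.
rewrite /npairs mulr_suml -big_split; apply: eq_bigr => i _ /=.
by rewrite mulr_suml -big_split; apply: eq_bigr => j _ /=; ring.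
Qed.

Lemma avg_desR : avg desR = npairs R n d * letter_mean R M.
Proof.
under eq_avg do rewrite desR_hoeffding.
rewrite avgD avg_cst// -[RHS]add0r; congr (_ + _).
under eq_avg do rewrite hoeffding_dpart.
rewrite avg_sum big1// => j _.
apply: (avg_centered1 T_gt0 (j := j)) => // w.
exact: (dpart_centered x0 e_sym e0 eb (@close_irr n d)).
Qed.

Let desR_centered w : desR w - avg desR = hoeffding x e w.
Proof. by rewrite desR_hoeffding avg_desR addrK. Qed.

Let K3 : R := d%:R ^+ 3 + n%:R * d%:R.

(** With N letters, the linear and quadratic parts carry the same factor (N^2 - 1)/(12 N^2); it
    multiplies the sum of the squared edge coefficients plus the number of close pairs. *)
Lemma var_desR_ge : K3 / 48 <= avg (fun w => (desR w - avg desR) ^+ 2).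
Proof.
under eq_avg do rewrite desR_centered.
rewrite (avg_hoeffding2E T_gt0 x0 e_sym e0 eb (@close_irr n d)) card_ord.
have Mneq0 : M.+1%:R != 0 :> R by rewrite pnatr_eq0.
have -> : \sum_j (\sum_t x j t ^+ 2) / M.+1%:R =
    (\sum_(j < n) edge_coef R d j ^+ 2) * ((M.+1%:R ^+ 2 - 1) / (12 * M.+1%:R ^+ 2)).
  rewrite mulr_suml; apply: eq_bigr => j _.
  under eq_bigr do rewrite exprMn.
  by rewrite -mulr_sumr sum_lin2; field.
have -> : \sum_j \sum_i \sum_s \sum_t e i j s t ^+ 2 =
    2 * npairs R n d * ((M.+1%:R ^+ 2 - 1) / 12).
  transitivity (\sum_(j < n) \sum_(i < n)
      ((close_pair d i j)%:R + (close_pair d j i)%:R) *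
      ((M.+1%:R ^+ 2 - 1) / 12) : R).
    apply: eq_bigr => j _; apply: eq_bigr => i _; rewrite -(sum_ker2 R M).
    rewrite /e; have [ij|ij] := boolP (close_pair d i j).
      rewrite close_pair_asym// addr0 mul1r; apply: eq_bigr => s _.
      by apply: eq_bigr => t _; rewrite mul1r mul0r addr0.
    case: (close_pair d j i); rewrite ?add0r ?mul1r ?mul0r.
      rewrite exchange_big; apply: eq_bigr => s _ /=.
      by apply: eq_bigr => t _; rewrite mul1r mul0r add0r.
    rewrite big1// => s _; rewrite big1// => t _.
    by rewrite !mul0r addr0 expr0n.
  under eq_bigr do rewrite -mulr_suml big_split /=.
  rewrite -mulr_suml big_split /= exchange_big /= -/(npairs R n d).
  by congr (_ * _); rewrite /npairs; ring.
(* Equality holds for two letters. Combined with d^3/3 + nd/2 >= (d^3 + nd)/3, this gives the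
   constant 48. *)
have q : 1 / 16 <= (M.+1%:R ^+ 2 - 1) / (12 * M.+1%:R ^+ 2) :> R.
  have M2 : 2 <= M.+1%:R :> R by rewrite ler_nat.
  rewrite ler_pdivlMr; last by rewrite mulr_gt0// exprn_gt0// ltr0n.
  by nra.
have -> : 2 * npairs R n d * ((M.+1%:R ^+ 2 - 1) / 12) / (2 * M.+1%:R ^+ 2) =
    npairs R n d * ((M.+1%:R ^+ 2 - 1) / (12 * M.+1%:R ^+ 2)) by field.
rewrite -mulrDl.
have := edge_coef_sum R dn; have := npairs_ge R dn.
move: q; set q := (_ - 1) / _; set c := \sum_j _; set N := npairs _ _ _.
rewrite /K3 => q16 N_ge c_ge.
have d0 := exprn_ge0 3 (ler0n R d); have nd0 := mulr_ge0 (ler0n R n) (ler0n R d).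
have cN0 : 0 <= c + N by lra.
by have := ler_wpM2l cN0 q16; lra.
Qed.

Variables (F F' : R -> R) (L1 L2 lam1 lam2 : R).
Hypothesis F'_bounded : forall s, `|F' s| <= L1.
Hypothesis F_taylor : forall s t, `|F s - F (s - t) - t * F' s| <= L2 * t ^+ 2.
Hypothesis lam1_gt0 : 0 < lam1.
Hypothesis lam2_gt0 : 0 < lam2.

(** Here D = 2d, m = 5d, and the sums of the second and fourth powers of the edge bounds are at most
    2d^3 and 2d^5. Hence 141 = 3 (2 + 45) from the variance bound, and 128 = 8 * 16 from the fourth
    moments, where n d^2 <= n d^3. *)
Lemma stein_desR :
  `|avg (fun w => (desR w - avg desR) * F (desR w)) -
    avg (fun w => (desR w - avg desR) ^+ 2) * avg (fun w => F' (desR w))| <=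
  L1 / 2 * (lam1 + 141 * d%:R ^+ 2 * K3 / lam1) +
  L2 / 2 * (4 * lam2 * K3 + 128 * d%:R ^+ 2 * K3 / lam2).
Proof.
have L1_ge0 : 0 <= L1 by rewrite (le_trans _ (F'_bounded 0)).
have L2_ge0 : 0 <= L2 by have := F_taylor 0 1; rewrite expr1n mulr1; exact: le_trans.
pose mu := avg desR.
have desE w : desR w = hoeffding x e w + mu by rewrite -desR_centered subrK.
(* The Hoeffding sum is the centered count, so the test function is translated by the mean. *)
have Fb s : `|F' (s + mu)| <= L1 by [].
have Ft s t : `|F (s + mu) - F (s - t + mu) - t * F' (s + mu)| <= L2 * t ^+ 2.
  by rewrite (addrAC s); exact: F_taylor.
have := stein_words T_gt0 x0 xb e_sym e0 eb (@close_irr n d) (close_degree dn)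
  (close_window_degree dn ^~ d_gt0) Fb Ft lam1_gt0 lam2_gt0.
have -> : avg (fun w => hoeffding x e w * F (hoeffding x e w + mu)) =
    avg (fun w => (desR w - mu) * F (desR w)).
  by apply: eq_avg => w; rewrite desE addrK.
have -> : avg (fun w => hoeffding x e w ^+ 2) = avg (fun w => (desR w - mu) ^+ 2).
  by apply: eq_avg => w; rewrite desE addrK.
have -> : avg (fun w => F' (hoeffding x e w + mu)) = avg (fun w => F' (desR w)).
  by apply: eq_avg => w; rewrite desE.
move=> /le_trans; apply.
have A4 := edge_bound_sum R dn 3; have A2 := edge_bound_sum R dn 1.
set a4 := \sum_j _ in A4 *; set a2 := \sum_j _ in A2 *.
have -> : #|'I_n| = n by rewrite card_ord.
rewrite !natrM; move: A4 A2; rewrite /K3.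
have := ler0n R n; have := ler0n R d.
set N : R := n%:R; set D : R := d%:R => D0 N0 A4 A2.
have D1 : 1 <= D by rewrite ler1n.
have D2 : 0 <= D ^+ 2 by exact: sqr_ge0.
have D3 : 0 <= D ^+ 3 by exact: exprn_ge0.
have D5 : 0 <= D ^+ 5 by exact: exprn_ge0.
have ND2 : 0 <= N * D ^+ 2 by rewrite mulr_ge0.
have ND3 : N * D ^+ 2 <= N * D ^+ 3.
  by rewrite ler_wpM2l// ler_weXn2l.
have DA2 : D ^+ 2 * a2 <= 2 * D ^+ 5.
  by rewrite (_ : 2 * D ^+ 5 = D ^+ 2 * (2 * D ^+ 3)) ?ler_wpM2l//; ring.
rewrite lerD// ler_wpM2l ?divr_ge0//.
  rewrite lerD2l ler_wpM2r ?invr_ge0 ?(ltW lam1_gt0)//.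
  by lra.
rewrite lerD// ?ler_wpM2r ?invr_ge0 ?(ltW lam2_gt0)//; last by lra.
rewrite [leRHS](_ : _ = lam2 * (4 * (D ^+ 3 + N * D))); last by ring.
rewrite ler_wpM2l ?(ltW lam2_gt0)//.
by have := mulr_ge0 D0 N0; lra.
Qed.

End WordStein.

(** * From words to permutations *)

Section WordsToPermutations.
Variables (R : realFieldType) (n d : nat).
Implicit Types (G : nat -> R) (p s : 'S_n).

Definition perm_avg (f : 'S_n -> R) : R := (\sum_p f p) / n`!%:R.

Definition perm_descents p := word_descents d (fun i => p i).

Lemma fact_neq0 : n`!%:R != 0 :> R.
Proof. by rewrite pnatr_eq0 -lt0n fact_gt0. Qed.

Lemma perm_avg_cst (c : R) : perm_avg (fun=> c) = c.
Proof.
rewrite /perm_avg sumr_const (_ : #|_| = n`!); last first.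
  by rewrite -card_Sn; apply: eq_card => p; rewrite !inE.
by rewrite -[_ *+ _]mulr_natr mulfK// fact_neq0.
Qed.

Lemma perm_avgD f g : perm_avg (fun p => f p + g p) = perm_avg f + perm_avg g.
Proof. by rewrite /perm_avg big_split /= mulrDl. Qed.

Lemma perm_avgZ c f : perm_avg (fun p => c * f p) = c * perm_avg f.
Proof. by rewrite /perm_avg -mulr_sumr mulrA. Qed.

Lemma perm_avgB f g : perm_avg (fun p => f p - g p) = perm_avg f - perm_avg g.
Proof. by rewrite /perm_avg sumrB mulrBl. Qed.

Lemma eq_perm_avg f g : f =1 g -> perm_avg f = perm_avg g.
Proof. by move=> fg; rewrite /perm_avg (eq_bigr g). Qed.

Lemma perm_avg_le f g : (forall p, f p <= g p) -> perm_avg f <= perm_avg g.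
Proof.
move=> fg; rewrite /perm_avg ler_wpM2r ?invr_ge0 ?ler0n//.
by apply: ler_sum => p _.
Qed.

Lemma ler_norm_perm_avg f : `|perm_avg f| <= perm_avg (fun p => `|f p|).
Proof.
rewrite /perm_avg normrM normfV (ger0_norm (ler0n _ _)).
by rewrite ler_wpM2r ?invr_ge0 ?ler0n// ler_norm_sum.
Qed.

Lemma eq_word_descents (w w' : 'I_n -> nat) :
  (forall i j, (w i < w j) = (w' i < w' j))%N ->
  word_descents d w = word_descents d w'.
Proof.
move=> ww'; apply: eq_card => -[i j]; rewrite !inE /=.
by rewrite ww'.
Qed.

Lemma word_descents_le (w : 'I_n -> nat) : (word_descents d w <= n * n)%N.
Proof.
by rewrite (leq_trans (max_card _))// card_prod card_ord.
Qed.

(** The rank of a position is the number of positions with smaller letters; these sets grow strictly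
    with the letter. *)
Lemma rank_perm (w : 'I_n -> nat) : injective w ->
  exists s : 'S_n, forall i j, (w i < w j)%N = (s i < s j)%N.
Proof.
move=> w_inj; pose A i := [set k | (w k < w i)%N].
have Amono i j : (w i < w j)%N -> (#|A i| < #|A j|)%N.
  move=> ij; apply: proper_card; apply/properP; split.
    by apply/fintype.subsetP => k; rewrite !inE => /ltn_trans; apply.
  by exists i; rewrite !inE ?ltnn.
have An i : (#|A i| < n)%N.
  rewrite -[ltnRHS]card_ord; apply: proper_card; apply/properP; split.
    exact: subset_predT.
  by exists i; rewrite ?inE ?ltnn.
have Ainj : injective (fun i => Ordinal (An i)).
  move=> i j /(congr1 val) /= Aij; apply: w_inj.
  by case: (ltngtP (w i) (w j)) => // /Amono; rewrite Aij ltnn.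
exists (perm Ainj) => i j; rewrite !permE /=.
apply/idP/idP => [/Amono //|]; rewrite ltnNge => /negP Aij.
rewrite ltnNge; apply/negP; rewrite leq_eqVlt => /orP[/eqP/w_inj ji|/Amono /ltnW//].
by apply: Aij; rewrite ji.
Qed.

(** If [r] is the relative order of [w], the rearrangement by [s] has relative order [s * r], and
    right multiplication by [r] is a bijection. *)
Lemma sum_perm_descents_inj (w : 'I_n -> nat) G : injective w ->
  \sum_(s : 'S_n) G (word_descents d (fun i => w (s i))) =
  \sum_(s : 'S_n) G (perm_descents s).
Proof.
move=> /rank_perm[r wr]; rewrite [RHS](reindex_inj (mulIg r)) /=.
apply: eq_bigr => s _; congr (G _); apply: eq_word_descents => i j.
by rewrite !permM wr.
Qed.

Section Letters.
Variable M : nat.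
Let T := 'I_M.+1.
Let T_gt0 : (0 < #|T|)%N. Proof. by rewrite card_ord. Qed.
Let wdes (w : {ffun 'I_n -> T}) := word_descents d (fun i => w i).

Lemma avg_word_perm (s : 'S_n) (Y : {ffun 'I_n -> T} -> R) :
  avg (fun w => Y [ffun i => w (s i)]) = avg Y.
Proof.
pose h (w : {ffun 'I_n -> T}) : {ffun 'I_n -> T} := [ffun i => w (s i)].
rewrite /avg [in RHS](reindex_inj (h := h))//.
move=> w w' /ffunP ww'; apply/ffunP => i.
by have := ww' (s^-1 i)%g; rewrite !ffunE permKV.
Qed.

(** Averaging a word over all rearrangements of its positions gives exactly the permutation average
    when its letters are distinct, and an error of at most 2B otherwise. *)
Lemma avg_words_perm_avg G B : (forall k, (k <= n * n)%N -> `|G k| <= B) ->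
  `|avg (fun w => G (wdes w)) - perm_avg (fun p => G (perm_descents p))| <=
  2 * B * (n * n)%:R / M.+1%:R.
Proof.
move=> GB; have B0 : 0 <= B by rewrite (le_trans _ (GB 0 _)).
pose E := perm_avg (fun p => G (perm_descents p)).
have EB : `|E| <= B.
  rewrite (le_trans (ler_norm_perm_avg _))// -[leRHS]perm_avg_cst.
  by apply: perm_avg_le => p; apply: GB; exact: word_descents_le.
pose A (w : {ffun 'I_n -> T}) :=
  perm_avg (fun s => G (word_descents d (fun i => w (s i)))).
have -> : avg (fun w => G (wdes w)) = avg A.
  rewrite /A /perm_avg.
  under [RHS]eq_avg do rewrite mulrC.
  rewrite avgZ avg_sum.
  rewrite (eq_bigr (fun=> avg (fun w => G (wdes w)))) => [|s _].
    rewrite mulrC; exact/esym/perm_avg_cst.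
  rewrite -[RHS](avg_word_perm s); apply: eq_avg => w; congr (G _).
  by apply: eq_word_descents => i j; rewrite !ffunE.
rewrite -/E -{1}(avg_cst 'I_n T_gt0 E) -avgB.
apply: (le_trans (ler_norm_avg T_gt0 _)).
(* The number of ordered pairs of positions with equal letters dominates the indicator of a
   collision, and each pair has probability 1/(M+1). *)
pose col (w : {ffun 'I_n -> T}) : R := \sum_i \sum_(j | i != j) (w i == w j)%:R.
apply: (le_trans (y := avg (fun w => 2 * B * col w))).
  apply: avg_le => w.
  have [/injectiveP winj|/injectivePn[i [j ij wij]]] := boolP (injectiveb w).
    rewrite /A /perm_avg (sum_perm_descents_inj G (w := fun i => w i)) ?subrr ?normr0.
      by rewrite !mulr_ge0// sumr_ge0// => i _; rewrite sumr_ge0.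
    by move=> i j /val_inj /winj.
  have col1 : 1 <= col w.
    rewrite /col (bigD1 i)//= (bigD1 j)//= wij eqxx -addrA lerDl.
    by rewrite addr_ge0 ?sumr_ge0// => k _; rewrite sumr_ge0.
  apply: (le_trans (y := 2 * B)); last by rewrite ler_peMr// mulr_ge0.
  rewrite (le_trans (ler_normB _ _))// mulr_natl mulr2n lerD//.
  rewrite (le_trans (ler_norm_perm_avg _))// -[leRHS]perm_avg_cst.
  by apply: perm_avg_le => p; apply: GB; exact: word_descents_le.
rewrite avgZ -mulrA ler_wpM2l ?mulr_ge0//.
have sum_cst (c : R) : n%:R * c = \sum_(i < n) c.
  by rewrite sumr_const card_ord mulr_natl.
rewrite avg_sum natrM -mulrA sum_cst.
apply: ler_sum => i _; rewrite avg_sum big_mkcond /=.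
rewrite sum_cst; apply: ler_sum => j _.
case: ifPn => [ij|_]; last by rewrite invr_ge0.
rewrite (avg_two_letters T_gt0 (fun t u => (t == u)%:R : R) ij) card_ord.
have -> : \sum_(t : T) \sum_(u : T) (t == u)%:R = M.+1%:R :> R.
  transitivity (\sum_(t : T) 1 : R); last by rewrite sumr_const card_ord.
  apply: eq_bigr => t _; rewrite (bigD1 t)//= eqxx big1 ?addr0// => u.
  by rewrite eq_sym => /negbTE ->.
by rewrite expr2 invfM mulrA divff ?mul1r// pnatr_eq0.
Qed.

End Letters.
End WordsToPermutations.

Local Open Scope classical_set_scope.

(** * Passage to the limit of large alphabets *)

Section PermStein.
Variables (R : realType) (n d : nat).

Lemma cvg_avg_words (G : nat -> R) :
  avg (fun w : {ffun 'I_n -> 'I_M.+1} => G (word_descents d (fun i => w i)))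
    @[M --> \oo] --> perm_avg (fun p : 'S_n => G (perm_descents d p)).
Proof.
(* Only the values of [G] up to [n * n] occur, so a finite sum bounds them all. *)
pose B := \sum_(k < (n * n).+1) `|G k|.
have GB k : (k <= n * n)%N -> `|G k| <= B.
  move=> kn; rewrite /B (bigD1 (Ordinal (kn : (k < (n * n).+1)%N)))//= lerDl.
  exact: sumr_ge0.
apply/cvgrPdist_le => e e0.
have C0 : (fun M => 2 * B * (n * n)%:R * harmonic M) @ \oo --> (0 : R).
  rewrite -[X in _ --> X](mulr0 (2 * B * (n * n)%:R)); apply: cvgMr.
  exact: cvg_harmonic.
move/cvgrPdist_le: C0 => /(_ _ e0); apply: filterS => M.
rewrite sub0r normrN => /(le_trans (ler_norm _)); apply: le_trans.
by rewrite distrC; exact: avg_words_perm_avg.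
Qed.

Definition descR (p : 'S_n) : R := (perm_descents d p)%:R.
Definition desc_mean : R := perm_avg descR.
Definition desc_var : R := perm_avg (fun p => (descR p - desc_mean) ^+ 2).

Let des M (w : {ffun 'I_n -> 'I_M.+1}) : R := desR R d w.

Let T_gt0 M : (0 < #|'I_M.+1|)%N. Proof. by rewrite card_ord. Qed.

Lemma cvg_avg_des (F : R -> R) :
  avg (fun w => F (@des M w)) @[M --> \oo] --> perm_avg (fun p => F (descR p)).
Proof. exact: (@cvg_avg_words (fun k => F k%:R)). Qed.

Lemma cvg_avg_mean : avg (@des M) @[M --> \oo] --> desc_mean.
Proof. exact: (@cvg_avg_des id). Qed.

(** The centering constant also depends on [M], so the product is expanded into averages that
    converge separately. *)
Lemma cvg_avg_centered (F : R -> R) :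
  avg (fun w => (@des M w - avg (@des M)) * F (des w)) @[M --> \oo] -->
  perm_avg (fun p => (descR p - desc_mean) * F (descR p)).
Proof.
have -> : perm_avg (fun p => (descR p - desc_mean) * F (descR p)) =
    perm_avg (fun p => descR p * F (descR p)) -
    desc_mean * perm_avg (fun p => F (descR p)).
  by rewrite -perm_avgZ -perm_avgB; apply: eq_perm_avg => p; rewrite mulrBl.
under eq_fun => M.
  rewrite [avg _](_ : _ = avg (fun w => @des M w * F (des w)) -
      avg (@des M) * avg (fun w => F (@des M w))); last first.
    by rewrite -avgZ -avgB; apply: eq_avg => w; rewrite mulrBl.
  over.
apply: cvgB; first exact: (@cvg_avg_des (fun z => z * F z)).
by apply: cvgM; [exact: cvg_avg_mean|exact: cvg_avg_des].
Qed.

(** The variance is E[(X - E X) X], an instance of the previous limit with F the identity. *)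
Lemma cvg_avg_var :
  avg (fun w => (@des M w - avg (@des M)) ^+ 2) @[M --> \oo] --> desc_var.
Proof.
have -> : desc_var = perm_avg (fun p => (descR p - desc_mean) * descR p).
  transitivity (perm_avg (fun p => (descR p - desc_mean) * descR p -
      desc_mean * (descR p - desc_mean))).
    by apply: eq_perm_avg => p; ring.
  rewrite perm_avgB perm_avgZ perm_avgB perm_avg_cst.
  by rewrite -/desc_mean subrr mulr0 subr0.
under eq_fun => M.
  rewrite [avg _](_ : _ = avg (fun w => (@des M w - avg (@des M)) * des w)); last first.
    transitivity (avg (fun w => (@des M w - avg (@des M)) * des w -
        avg (@des M) * (des w - avg (@des M)))).
      by apply: eq_avg => w; ring.
    by rewrite avgB avgZ avgB avg_cst// subrr mulr0 subr0.
  over.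
exact: (@cvg_avg_centered id).
Qed.

Hypothesis d_gt0 : (0 < d)%N.
Hypothesis dn : (2 * d <= n)%N.
Let K3 : R := d%:R ^+ 3 + n%:R * d%:R.

(** The bound for words is uniform in [M], so it survives the limit. *)
Lemma desc_var_ge : K3 / 48 <= desc_var.
Proof.
apply: (cvgr_to_ge cvg_avg_var).
by near=> M; apply: var_desR_ge => //; near: M; exact: nbhs_infty_gt.
Unshelve. all: by end_near. Qed.

Variables (F F' : R -> R) (L1 L2 lam1 lam2 : R).
Hypothesis F'_bounded : forall s, `|F' s| <= L1.
Hypothesis F_taylor : forall s t, `|F s - F (s - t) - t * F' s| <= L2 * t ^+ 2.
Hypothesis lam1_gt0 : 0 < lam1.
Hypothesis lam2_gt0 : 0 < lam2.

Lemma stein_perm :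
  `|perm_avg (fun p => (descR p - desc_mean) * F (descR p)) -
    desc_var * perm_avg (fun p => F' (descR p))| <=
  L1 / 2 * (lam1 + 141 * d%:R ^+ 2 * K3 / lam1) +
  L2 / 2 * (4 * lam2 * K3 + 128 * d%:R ^+ 2 * K3 / lam2).
Proof.
have : (fun M => `|avg (fun w => (@des M w - avg (@des M)) * F (des w)) -
    avg (fun w => (@des M w - avg (@des M)) ^+ 2) * avg (fun w => F' (@des M w))|)
    @ \oo --> `|perm_avg (fun p => (descR p - desc_mean) * F (descR p)) -
    desc_var * perm_avg (fun p => F' (descR p))|.
  apply: cvg_norm; apply: cvgB; first exact: cvg_avg_centered.
  by apply: cvgM; [exact: cvg_avg_var|exact: cvg_avg_des].
move/cvgr_to_le; apply.
by near=> M; apply: stein_desR => //; near: M; exact: nbhs_infty_gt.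
Unshelve. all: by end_near. Qed.

End PermStein.

(** * The Stein equation *)

Section SteinEquation.
Variable R : realType.
Let mu := @lebesgue_measure R.

Lemma lipschitz_continuous (g : R -> R) K :
  (forall x y, `|g x - g y| <= K * `|x - y|) -> continuous g.
Proof.
move=> gK x; apply/cvgrPdist_le => e e0.
have K0 : 0 < `|K| + 1 by rewrite ltr_pwDr.
near=> y.
apply: (le_trans (gK x y)); apply: (le_trans (y := (`|K| + 1) * `|x - y|)).
  by rewrite ler_wpM2r// (le_trans (ler_norm _))// lerDl.
rewrite mulrC -ler_pdivlMr//; near: y.
by apply: cvgr_dist_le; [exact: cvg_id|rewrite divr_gt0].
Unshelve. all: by end_near. Qed.

Lemma MVT_everywhere (f df : R -> R) (x y : R) :
  (forall x : R, is_derive x 1 f (df x)) ->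
  exists2 c, `|c - x| <= `|y - x| & f y - f x = df c * (y - x).
Proof.
move=> fdf.
have cf : continuous f.
  by move=> z; apply/differentiable_continuous/derivable1_diffP; have [] := fdf z.
have mvt a b : a <= b -> exists2 c, c \in `[a, b]%R & f b - f a = df c * (b - a).
  by move=> ab; apply: MVT_segment => //; exact: continuous_subspaceT.
have [xy|/ltW yx] := leP x y.
  have [c /andP[/=]] := mvt _ _ xy; rewrite !bnd_simp => xc cy ->; exists c => //.
  by rewrite !ger0_norm ?subr_ge0// lerD2r.
have [c /andP[/=]] := mvt _ _ yx; rewrite !bnd_simp => yc cx fE; exists c.
  by rewrite !ler0_norm ?subr_le0// lerN2 lerD2r.
by rewrite -opprB fE -mulrN opprB.
Qed.

Lemma lipschitz_derive (f df : R -> R) L : (forall x : R, is_derive x 1 f (df x)) ->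
  (forall x, `|df x| <= L) -> forall x y, `|f x - f y| <= L * `|x - y|.
Proof.
move=> fdf dfL x y; have [c _ ->] := MVT_everywhere y x fdf.
by rewrite normrM ler_wpM2r.
Qed.

(** As [df] is only Lipschitz, the mean value theorem replaces a second-order expansion: the
    increment is [t * df c] with c within |t| of s. *)
Lemma taylor_lipschitz (f df : R -> R) L : (forall x : R, is_derive x 1 f (df x)) ->
  (forall x y, `|df x - df y| <= L * `|x - y|) ->
  forall s t, `|f s - f (s - t) - t * df s| <= L * t ^+ 2.
Proof.
move=> fdf dfL s t; have [c + fE] := MVT_everywhere s (s - t) fdf.
rewrite addrAC subrr add0r normrN => cs.
have -> : f s - f (s - t) - t * df s = t * (df c - df s).
  by rewrite -[f s - _]opprB fE addrAC subrr add0r; ring.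
rewrite normrM -[in leRHS]real_normK ?num_real// expr2.
rewrite (le_trans (ler_wpM2l _ (dfL _ _)))// mulrCA ler_wpM2l//.
  by have := dfL 1 0; rewrite subr0 normr1 mulr1; exact: le_trans.
by rewrite ler_wpM2l.
Qed.

Lemma std_normal_pdfE (x : R) :
  normal_pdf 0 1 x = normal_peak 1 * expR (- (x ^+ 2 / 2)).
Proof.
rewrite normal_pdfE ?oner_neq0// /normal_fun subr0 expr1n mulNr.
by rewrite -[1 *+ 2]/(2%:R).
Qed.

Variables (g : R -> R) (A K : R).
Hypothesis A_gt0 : 0 < A.
Hypothesis g_lip : forall x y, `|g x - g y| <= K * `|x - y|.
Hypothesis g_supp : forall x, A <= `|x| -> g x = 0.
Let phi : R -> R := normal_pdf 0 1.
Let gphi (x : R) : R := g x * phi x.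
Hypothesis int_g : (\int[mu]_(t in `[- A - 1, A]) gphi t)%R = 0.

Let peak_gt0 : 0 < normal_peak (1 : R).
Proof. by rewrite normal_peak_gt0// oner_neq0. Qed.

(** The classical solution of f' - x f = g, namely 1/phi times the integral of g phi. Starting at -A
    - 1 rather than -A loses nothing, since g vanishes there, and leaves room to differentiate at
    -A. *)
Let f (x : R) : R := (normal_peak 1)^-1 * expR (x ^+ 2 / 2) *
  (\int[mu]_(t in `[- A - 1, x]) gphi t)%R.
Let df (x : R) : R := x * f x + g x.

Let cont_gphi : continuous gphi.
Proof.
move=> x; apply: cvgM; first exact: (lipschitz_continuous g_lip).
by apply: continuous_normal_pdf; rewrite oner_neq0.
Qed.

Let int_gphi a b : mu.-integrable `[a, b] (EFin \o gphi).
Proof.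
apply: continuous_compact_integrable; first exact: segment_compact.
exact: continuous_subspaceT.
Qed.

Let gphi0 (D : set R) : (forall x, D x -> A <= `|x|) ->
  (\int[mu]_(t in D) gphi t)%R = 0.
Proof.
move=> DA; rewrite (@eq_Rintegral _ _ _ _ _ (fun=> 0)) ?Rintegral0//.
  by rewrite /Rintegral integral0.
by move=> x /set_mem /DA xA; rewrite /gphi g_supp// mul0r.
Qed.

(** To the left of -A the integrand vanishes; to the right of A the integral has reached its full
    value, which is zero because g has Gaussian mean zero. *)
Let f_supp (x : R) : A <= `|x| -> f x = 0.
Proof.
rewrite ler_normr => xA; rewrite /f; apply/eqP; rewrite mulf_eq0; apply/orP; right.
case/orP: xA => xA.
  have := @Rintegral_itvB _ gphi (BLeft (- A - 1)) (BRight x) A (int_gphi _ _).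
  rewrite int_g subr0 => -> //; last by rewrite bnd_simp; have := A_gt0; lra.
  apply/eqP/gphi0 => y /=; rewrite in_itv/= => /andP[/ltW Ay _].
  by rewrite ler_normr Ay.
apply/eqP/gphi0 => y /=; rewrite in_itv/= => /andP[_ yx].
by rewrite ler_normr; apply/orP; right; lra.
Qed.

Let f_derive (x : R) : is_derive x 1 f (df x).
Proof.
(* In the first case f vanishes near x; in the second x lies to the right of the lower limit of
   integration and the fundamental theorem of calculus applies. *)
have [xA|Ax] := leP x (- A - 1/2).
  have -> : df x = 0.
    by rewrite /df f_supp ?g_supp ?mulr0 ?addr0// ler_normr; apply/orP; right; lra.
  apply: (@near_eq_is_derive _ _ _ (cst 0)) => //.
  near=> y; rewrite f_supp//.
  have : y < - A by near: y; apply: lt_nbhsl; lra.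
  by move=> yA; rewrite ler_normr; apply/orP; right; lra.
have xx1 : x < x + 1 by rewrite ltrDl.
have ax : - A - 1 < x by lra.
have [FD FE] := continuous_FTC1_closed xx1 (int_gphi _ _) ax (@cont_gphi x).
have dF : is_derive x 1 (fun x : R => (\int[mu]_(t in `[(- A - 1)%R, x]) gphi t)%R)
    (gphi x).
  by split; [exact: FD|rewrite -derive1E; exact: FE].
have dq : is_derive x 1 (fun x : R => x ^+ 2 / 2) x.
  rewrite (_ : (fun x : R => x ^+ 2 / 2) = 2^-1 \*: (id ^+ 2)); last first.
    by apply/funext => y /=; rewrite mulrC.
  apply: is_derive_eq; rewrite /= expr1 mulr_natl.
  by rewrite -![_ *: _]/(_ * _); field.
have dE : is_derive x 1 (fun x : R => expR (x ^+ 2 / 2)) (expR (x ^+ 2 / 2) * x).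
  exact: (is_derive1_comp (f := expR)).
have dfE : f = (fun x : R => (normal_peak 1)^-1) * (fun x : R => expR (x ^+ 2 / 2)) *
    (fun x : R => (\int[mu]_(t in `[(- A - 1)%R, x]) gphi t)%R) by [].
rewrite dfE; apply: is_derive_eq.
rewrite -![_ *: _]/(_ * _) /df /f /gphi /phi std_normal_pdfE expRN /= mulr0 addr0.
have E0 : expR (x ^+ 2 / 2) != 0 by rewrite gt_eqF ?expR_gt0.
have P0 : normal_peak 1 != 0 :> R by rewrite gt_eqF.
rewrite mulrfctE /=; set I := (\int[_]_(_ in _) _)%R; set E := expR _.
move: E0; rewrite -/E; move: P0; move: (normal_peak 1) E I => p E I P0 E0.
by field; rewrite P0.
Unshelve. all: by end_near. Qed.

(** Bootstrap: f is continuous with compact support, hence bounded; then [df], equal to x f + g, is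
    bounded, so f is Lipschitz, and therefore so is [df]. *)
Lemma stein_equation : exists f df : R -> R, exists L1 L2 : R,
  [/\ forall x : R, is_derive x 1 f (df x), forall x, df x = x * f x + g x,
      forall x, `|df x| <= L1 &
      forall x y, `|df x - df y| <= L2 * `|x - y|].
Proof.
have cf : continuous f.
  by move=> z; apply/differentiable_continuous/derivable1_diffP; have [] := f_derive z.
have AA : - A <= A by have := A_gt0; lra.
have [c _ fc] : exists2 c, c \in `[- A, A]%R &
    forall t, t \in `[- A, A]%R -> `|f t| <= `|f c|.
  apply: EVT_max => //; apply: continuous_subspaceT => z.
  by apply: cvg_norm; exact: cf.
have K0 : 0 <= K by have := g_lip 1 0; rewrite subr0 normr1 mulr1; exact: le_trans.
have A0 := ltW A_gt0.
have g_bound x : `|g x| <= 2 * A * K.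
  have [Ax|xA] := leP A `|x|; first by rewrite g_supp// normr0 !mulr_ge0.
  have := g_lip x A; rewrite (g_supp (x := A)) ?ler_norm// subr0 => /le_trans; apply.
  rewrite mulrC ler_wpM2r//; move/ltr_normlP: xA => [? ?].
  by rewrite ler_norml; apply/andP; split; lra.
pose C := `|f c|.
have C0 : 0 <= C := normr_ge0 _.
have f_bound x : `|f x| <= C.
  have [Ax|] := leP A `|x|; first by rewrite f_supp// normr0.
  by move=> /ltW; rewrite ler_norml => xA; apply: fc; rewrite in_itv.
pose D := A * C + 2 * A * K.
have D0 : 0 <= D by rewrite addr_ge0 ?mulr_ge0.
have df_bound x : `|df x| <= D.
  have [Ax|xA] := leP A `|x|.
    by rewrite /df f_supp// g_supp// mulr0 addr0 normr0.
  by rewrite (le_trans (ler_normD _ _))// normrM lerD// ler_pM// ltW.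
have f_lip := lipschitz_derive f_derive df_bound.
have df_lip0 x y : `|x| < A -> `|df x - df y| <= (A * D + C + K) * `|x - y|.
  move=> xA; have -> : df x - df y = x * (f x - f y) + (x - y) * f y + (g x - g y).
    by rewrite /df; ring.
  rewrite !mulrDl (le_trans (ler_normD _ _))// lerD//.
  rewrite (le_trans (ler_normD _ _))// lerD//.
    by rewrite normrM -mulrA ler_pM// ltW.
  by rewrite -mulrDl normrM mulrC ler_wpM2r.
exists f, df, D, (A * D + C + K); split=> //.
move=> x y; have [Ax|xA] := leP A `|x|; last exact: df_lip0.
have [Ay|yA] := leP A `|y|; last by rewrite distrC (distrC x y) df_lip0.
rewrite /df !f_supp// !g_supp// !mulr0 !addr0 subr0 normr0.
by rewrite !mulr_ge0 ?addr_ge0 ?mulr_ge0.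
Qed.

End SteinEquation.

(** * Standardized descents *)

Section StandardizedDescents.
Variable R : realType.

Definition stdW n d (p : 'S_n) : R :=
  (descR R d p - desc_mean R n d) / Num.sqrt (desc_var R n d).

(** [stein_perm] is applied to f composed with the standardization, which divides the bound on F' by
    s and the Lipschitz constant by v. *)
Lemma stein_stdW n d (f df : R -> R) (L1 L2 : R) :
  (0 < d)%N -> (2 * d <= n)%N ->
  (forall x : R, is_derive x 1 f (df x)) -> (forall x, `|df x| <= L1) ->
  (forall x y, `|df x - df y| <= L2 * `|x - y|) ->
  `|perm_avg (fun p : 'S_n => stdW d p * f (stdW d p)) -
    perm_avg (fun p : 'S_n => df (stdW d p))| <=
  10 ^+ 6 * (L1 + L2) * Num.sqrt (d%:R / n%:R).
Proof.
move=> d0 dn fdf dfL dfL2.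
have L10 : 0 <= L1 by rewrite (le_trans _ (dfL 0)).
have L20 : 0 <= L2 by have := dfL2 1 0; rewrite subr0 normr1 mulr1; exact: le_trans.
set mu := desc_mean R n d; set v := desc_var R n d; set s := Num.sqrt v.
have d0R : 0 < d%:R :> R by rewrite ltr0n.
have n0R : 0 < n%:R :> R by rewrite ltr0n; lia.
pose K3 : R := d%:R ^+ 3 + n%:R * d%:R.
have K30 : 0 < K3 by rewrite addr_gt0 ?mulr_gt0 ?exprn_gt0.
have vK : K3 / 48 <= v := desc_var_ge R d0 dn.
have v0 : 0 < v by rewrite (lt_le_trans _ vK)// divr_gt0.
have s0 : 0 < s by rewrite sqrtr_gt0.
have s2 : s ^+ 2 = v by rewrite sqr_sqrtr// ltW.
pose F x := f ((x - mu) / s); pose F' x := df ((x - mu) / s) / s.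
have FL x : `|F' x| <= L1 / s by rewrite normrM normfV (gtr0_norm s0) ler_pM2r ?invr_gt0.
have FT x t : `|F x - F (x - t) - t * F' x| <= L2 / v * t ^+ 2.
  have := taylor_lipschitz fdf dfL2 ((x - mu) / s) (t / s).
  rewrite -mulrBl (addrAC x) -/(F x) -/(F (x - t)) expr_div_n s2.
  have -> : t * F' x = t / s * df ((x - mu) / s) by rewrite /F' mulrA mulrAC.
  by rewrite [L2 / v * _]mulrAC -[L2 * _ / v]mulrA.
set r := d%:R / n%:R; set tau := Num.sqrt r.
have r0 : 0 < r by rewrite divr_gt0.
have tau0 : 0 < tau by rewrite sqrtr_gt0.
have tau2 : tau ^+ 2 = r by rewrite sqr_sqrtr// ltW.
(* These weights bring every error term, after division by s, to the order of tau, the square root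
   of d/n. *)
have := stein_perm d0 dn FL FT (mulr_gt0 v0 tau0) (mulr_gt0 s0 tau0).
rewrite -/mu -/v -/K3.
have -> : perm_avg (fun p : 'S_n => (descR R d p - mu) * F (descR R d p)) =
    s * perm_avg (fun p : 'S_n => stdW d p * f (stdW d p)).
  rewrite -perm_avgZ; apply: eq_perm_avg => p; rewrite /stdW -/mu -/v -/s /F.
  by field; rewrite gt_eqF.
have -> : v * perm_avg (fun p : 'S_n => F' (descR R d p)) =
    s * perm_avg (fun p : 'S_n => df (stdW d p)).
  rewrite -!perm_avgZ; apply: eq_perm_avg => p; rewrite /stdW -/mu -/v -/s /F' -s2.
  by field; rewrite gt_eqF.
rewrite -mulrBr normrM (gtr0_norm s0) mulrC -ler_pdivlMr// => /le_trans; apply.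
have q1 : K3 / v <= 48 by rewrite ler_pdivrMr// -ler_pdivrMl//; lra.
have q2 : d%:R ^+ 2 * K3 / v ^+ 2 <= 48 ^+ 2 * r.
  (* The difference is exactly d^4/n; this is where the ratio d/n enters. *)
  have K3r : d%:R ^+ 2 <= r * K3.
    rewrite /r /K3 -subr_ge0 (_ : _ - _ = d%:R ^+ 4 / n%:R) ?divr_ge0 ?exprn_ge0//.
    by field; rewrite gt_eqF.
  rewrite ler_pdivrMr ?exprn_gt0//.
  have Kv : K3 <= 48 * v by lra.
  have h1 : K3 ^+ 2 <= (48 * v) ^+ 2 
    by rewrite lerXn2r// nnegrE ?(ltW K30)// mulr_ge0// ltW.
  have h2 := ler_wpM2r (ltW K30) K3r.
  have h3 := ler_wpM2l (ltW r0) h1.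
  lra.
have q3 : d%:R ^+ 2 * K3 / v ^+ 2 / tau <= 48 ^+ 2 * tau.
  by rewrite ler_pdivrMr// (le_trans q2)// -tau2 [tau ^+ 2]expr2 mulrA.
have E1 : L1 / s / 2 * (v * tau + 141 * d%:R ^+ 2 * K3 / (v * tau)) / s =
    L1 / 2 * (tau + 141 * (d%:R ^+ 2 * K3 / v ^+ 2 / tau)).
  by rewrite -s2; field; rewrite !gt_eqF.
have E2 : L2 / v / 2 * (4 * (s * tau) * K3 + 128 * d%:R ^+ 2 * K3 / (s * tau)) / s =
    L2 / 2 * (4 * tau * (K3 / v) + 128 * (d%:R ^+ 2 * K3 / v ^+ 2 / tau)).
  by rewrite -s2; field; rewrite !gt_eqF.
rewrite mulrDl E1 E2.
have h1 : L1 / 2 * (tau + 141 * (d%:R ^+ 2 * K3 / v ^+ 2 / tau)) <=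
    L1 / 2 * (tau + 141 * (48 ^+ 2 * tau)).
  by rewrite ler_wpM2l ?divr_ge0// lerD2l ler_wpM2l.
have h2 : L2 / 2 * (4 * tau * (K3 / v) + 128 * (d%:R ^+ 2 * K3 / v ^+ 2 / tau)) <=
    L2 / 2 * (4 * tau * 48 + 128 * (48 ^+ 2 * tau)).
  by rewrite ler_wpM2l ?divr_ge0// lerD// ler_wpM2l// mulr_ge0// ltW.
(* The coefficients of L1 tau and L2 tau are below 2 * 10^5, so 10^6 is generous. *)
apply: (le_trans (lerD h1 h2)).
by have := mulr_ge0 L10 (ltW tau0); have := mulr_ge0 L20 (ltW tau0); lra.
Qed.

(** Supplies tightness, through Chebyshev's inequality, in [std_avg_liminf]. *)
Lemma stdW_moment2 n d : (0 < d)%N -> (2 * d <= n)%N ->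
  perm_avg (fun p : 'S_n => stdW d p ^+ 2) = 1.
Proof.
move=> d0 dn.
have v0 : 0 < desc_var R n d.
  rewrite (lt_le_trans _ (desc_var_ge R d0 dn))// divr_gt0// ltr_pwDr ?exprn_ge0//.
  by rewrite mulr_gt0// ltr0n; lia.
transitivity (perm_avg (fun p : 'S_n =>
    (desc_var R n d)^-1 * (descR R d p - desc_mean R n d) ^+ 2)).
  by apply: eq_perm_avg => p; rewrite /stdW expr_div_n sqr_sqrtr 1?mulrC// ltW.
by rewrite perm_avgZ -/(desc_var R n d) mulVf// gt_eqF.
Qed.

End StandardizedDescents.

(** * Lipschitz approximations of indicators of intervals *)

Section Trapezoid.
Variable R : realType.
Implicit Types a b w x : R.

(** For w > 0 the ramps are [a, a + w] and [b - w, b]. If b - a < 2w the peak stays below 1, and b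
    <= a gives the zero function. *)
Definition trapezoid a b w x : R :=
  Num.max 0 (Num.min 1 (Num.min ((x - a) / w) ((b - x) / w))).

Lemma trapezoid_ge0 a b w x : 0 <= trapezoid a b w x.
Proof. by rewrite le_max lexx. Qed.

Lemma trapezoid_le1 a b w x : trapezoid a b w x <= 1.
Proof. by rewrite ge_max ler01 ge_min lexx. Qed.

Lemma trapezoid_out a b w x : 0 < w -> (x <= a) || (b <= x) -> trapezoid a b w x = 0.
Proof.
move=> w0 xab; apply/max_idPl; rewrite !ge_min.
apply/orP; right; case/orP: xab => h; apply/orP; [left|right];
  by rewrite pmulr_lle0 ?invr_gt0// subr_le0.
Qed.

Lemma trapezoid_in a b w x : 0 < w -> a + w <= x -> x <= b - w ->
  trapezoid a b w x = 1.
Proof.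
move=> w0 ax xb; rewrite /trapezoid (min_idPl _) ?(max_idPr _)// le_min.
by rewrite !ler_pdivlMr// !mul1r; apply/andP; split; lra.
Qed.

Lemma trapezoid_lipschitz a b w x y : 0 < w ->
  `|trapezoid a b w x - trapezoid a b w y| <= w^-1 * `|x - y|.
Proof.
move=> w0; have w'0 : 0 < w^-1 by rewrite invr_gt0.
have min_lip (e p q p' q' : R) : `|p - p'| <= e -> `|q - q'| <= e ->
    `|Num.min p q - Num.min p' q'| <= e.
  rewrite !ler_norml => /andP[? ?] /andP[? ?].
  by case: (leP p q) => ?; case: (leP p' q') => ?; apply/andP; split; lra.
have max_lip (e p p' : R) : `|p - p'| <= e -> `|Num.max 0 p - Num.max 0 p'| <= e.
  rewrite !ler_norml => /andP[? ?].
  by case: (leP 0 p) => ?; case: (leP 0 p') => ?; apply/andP; split; lra.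
have e0 : 0 <= w^-1 * `|x - y| by rewrite mulr_ge0// ltW.
apply: max_lip; apply: (min_lip); first by rewrite subrr normr0.
apply: min_lip; rewrite -mulrBl normrM (gtr0_norm w'0) mulrC ler_pM2l//.
  by rewrite opprB addrA subrK.
by rewrite distrC opprB addrC addrA subrK.
Qed.

End Trapezoid.

(** * Convergence to the Gaussian *)

Section GaussianIntegral.
Variable R : realType.
Let mu := @lebesgue_measure R.
Let phi : R -> R := normal_pdf 0 1.

Definition gauss_int (h : R -> R) : R := (\int[mu]_x (h x * phi x))%R.
Definition gauss_cdf (t : R) : R := fine (normal_prob 0 1 `]-oo, t]).

Lemma integrable_gauss (h : R -> R) : measurable_fun setT h ->
  (forall x, `|h x| <= 1) -> mu.-integrable setT (EFin \o (fun x => h x * phi x)).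
Proof.
move=> mh h1; apply: (le_integrable _ _ _ (integrable_normal_pdf 0 1)) => //.
  by apply/measurable_EFinP/measurable_funM => //; exact: measurable_normal_pdf.
move=> x _ /=; rewrite lee_fin normrM ler_piMl//.
Qed.

Lemma gauss_int_le1 (h : R -> R) : measurable_fun setT h ->
  (forall x, `|h x| <= 1) -> gauss_int h <= 1.
Proof.
move=> mh h1; apply: (le_trans (y := (\int[mu]_x phi x)%R)).
  apply: le_Rintegral => //; first exact: integrable_gauss.
    exact: integrable_normal_pdf.
  move=> x _; rewrite ler_piMl ?normal_pdf_ge0//.
  exact: le_trans (ler_norm _) (h1 x).
by rewrite /Rintegral integral_normal_pdf.
Qed.

Lemma gauss_int_supp (h : R -> R) (D : set R) : (forall x, ~ D x -> h x = 0) ->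
  (\int[mu]_(x in D) (h x * phi x))%R = gauss_int h.
Proof.
move=> hD; rewrite Rintegral_mkcond; congr (Rintegral _ _ _).
apply/funext => x; rewrite patchE; case: ifPn => // /negP xD.
by rewrite hD ?mul0r// => Dx; apply: xD; rewrite inE.
Qed.

Lemma gauss_cdfB s t : s <= t ->
  gauss_cdf t - gauss_cdf s = (\int[mu]_(x in `]s, t]) phi x)%R.
Proof.
move=> st; rewrite /gauss_cdf /normal_prob.
rewrite -(@Rintegral_itvB _ phi -oo%O (BRight t) s) ?bnd_simp//.
by apply: (integrableS measurableT) => //; exact: integrable_normal_pdf.
Qed.

(** The trapezoid dominates the indicator of its plateau; when the plateau is empty the left-hand
    side is at most zero. *)
Lemma gauss_int_trapezoid a b w : 0 < w ->
  gauss_cdf (b - w) - gauss_cdf (a + w) <= gauss_int (trapezoid a b w).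
Proof.
move=> w0.
have mt : measurable_fun setT (trapezoid a b w).
  apply: continuous_measurable_fun; apply: lipschitz_continuous => x y.
  exact: trapezoid_lipschitz.
have t1 x : `|trapezoid a b w x| <= 1.
  by rewrite ger0_norm ?trapezoid_ge0 ?trapezoid_le1.
have [ab|/ltW ab] := leP (a + w) (b - w); last first.
  apply: (le_trans (y := 0)).
    rewrite -opprB oppr_le0 gauss_cdfB//.
    by apply: Rintegral_ge0 => x _; exact: normal_pdf_ge0.
  apply: Rintegral_ge0 => x _.
  by rewrite mulr_ge0 ?normal_pdf_ge0// trapezoid_ge0.
rewrite gauss_cdfB// Rintegral_mkcond; apply: le_Rintegral => //.
- rewrite -restrict_EFin -integrable_mkcond//.
  by apply: (integrableS measurableT) => //; exact: integrable_normal_pdf.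
- exact: integrable_gauss.
move=> x _; rewrite patchE; case: ifPn => [|_]; last first.
  by rewrite mulr_ge0 ?normal_pdf_ge0// trapezoid_ge0.
rewrite inE /= in_itv /= => /andP[/ltW ax xb].
by rewrite trapezoid_in// mul1r.
Qed.

End GaussianIntegral.

(** * Asymptotic lower bounds for averages of test functions *)

Section GaussianLimit.
Variables (R : realType) (d : nat -> nat).
Let tau n : R := Num.sqrt ((d n)%:R / n%:R).
Hypothesis d_gt0 : forall n, (0 < n)%N -> (0 < d n)%N.
Hypothesis tau_cvg0 : tau @ \oo --> (0 : R).

Definition std_avg (h : R -> R) n : R :=
  perm_avg (fun p : 'S_n => h (stdW R (d n) p)).

(** Once tau <= 1/2 one has d/n <= 1/4. *)
Lemma near_small_d : \forall n \near \oo, (0 < d n)%N /\ (2 * d n <= n)%N.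
Proof.
near=> n.
have n0 : (0 < n)%N by near: n; exact: nbhs_infty_gt.
have n0R : 0 < n%:R :> R by rewrite ltr0n.
split; first exact: d_gt0.
have : `|tau n| <= 2^-1.
  by near: n; apply: cvgr0_norm_le => //; rewrite invr_gt0.
rewrite ger0_norm ?sqrtr_ge0// => t2.
have : tau n ^+ 2 <= 2^-1 ^+ 2 by rewrite lerXn2r ?nnegrE ?sqrtr_ge0.
rewrite sqr_sqrtr ?divr_ge0// ler_pdivrMr// -(ler_nat R) natrM => h.
by have := ler0n R (d n); lra.
Unshelve. all: by end_near. Qed.

(** Solving the Stein equation for g turns E[g(W)] into -(E[W f(W)] - E[f'(W)]), which is O(tau). *)
Lemma cvg_std_avg_stein (g : R -> R) A K : 0 < A ->
  (forall x y, `|g x - g y| <= K * `|x - y|) ->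
  (forall x, A <= `|x| -> g x = 0) -> gauss_int g = 0 ->
  std_avg g @ \oo --> (0 : R).
Proof.
move=> A0 gK gA g0.
have int0 :
    (\int[lebesgue_measure]_(t in `[(- A - 1)%R, A]) (g t * normal_pdf 0 1 t))%R = 0.
  rewrite (@gauss_int_supp _ g)// => x /= xA; apply: gA; rewrite leNgt; apply/negP.
  by move=> /ltr_normlP[? ?]; apply: xA; rewrite in_itv/=; apply/andP; split; lra.
have [f [df [L1 [L2 [fdf dfE dfL dfL2]]]]] := stein_equation A0 gK gA int0.
pose C : R := 10 ^+ 6 * (L1 + L2).
apply/cvgrPdist_le => e e0.
have Ct : (fun n => C * tau n) @ \oo --> (0 : R).
  by rewrite -[X in _ --> X](mulr0 C); exact: cvgMr.
near=> n; rewrite sub0r normrN.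
have [dn0 dn] : (0 < d n)%N /\ (2 * d n <= n)%N by near: n; exact: near_small_d.
have -> : std_avg g n =
    - (perm_avg (fun p : 'S_n => stdW R (d n) p * f (stdW R (d n) p)) -
    perm_avg (fun p : 'S_n => df (stdW R (d n) p))).
  rewrite opprB -perm_avgB; apply: eq_perm_avg => p.
  by rewrite dfE addrC addKr.
rewrite normrN (le_trans (stein_stdW dn0 dn fdf dfL dfL2))//.
have : `|C * tau n| <= e by near: n; exact: cvgr0_norm_le.
exact: le_trans (ler_norm _).
Unshelve. all: by end_near. Qed.

(** Subtracting a multiple [c * k] of a wide trapezoid makes the Gaussian mean zero, so E[h(W)] is
    asymptotically c E[k(W)]. Here c is at least the Gaussian mean of h, and E[k(W)] is close to 1
    since E[W^2] = 1. *)
Lemma std_avg_liminf (h : R -> R) A K e : 0 < e ->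
  (forall x y, `|h x - h y| <= K * `|x - y|) ->
  (forall x, 0 <= h x <= 1) ->
  (forall x, A <= `|x| -> h x = 0) ->
  \forall n \near \oo, gauss_int h - e <= std_avg h n.
Proof.
move=> e0 hK h01 hA.
have h_ge0 x : 0 <= h x by have /andP[] := h01 x.
have h_le1 x : h x <= 1 by have /andP[] := h01 x.
have K0 : 0 <= K by have := hK 1 0; rewrite subr0 normr1 mulr1; exact: le_trans.
have h1 x : `|h x| <= 1 by rewrite ger0_norm.
have mh : measurable_fun setT h.
  exact: continuous_measurable_fun (lipschitz_continuous hK).
(* The first summand places the support of h where k equals 1; the others give B >= 1 and B >= 2/e,
   hence B^-2 <= e/2. *)
pose B := `|A| + 1 + 2 / e.
have e2 : 0 < 2 / e by rewrite divr_gt0.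
have B1 : 1 <= B by rewrite /B; have := normr_ge0 A; lra.
have B0 : 0 < B by rewrite (lt_le_trans ltr01).
have BA : A <= B by rewrite /B; have := ler_norm A; lra.
have Be : (B ^+ 2)^-1 <= e / 2.
  rewrite -[leRHS]invrK lef_pV2 ?posrE ?invr_gt0 ?divr_gt0 ?exprn_gt0// invf_div.
  apply: (le_trans (y := B)); first by rewrite /B; have := normr_ge0 A; lra.
  by rewrite expr2 ler_peMr// ltW.
pose k := trapezoid (- B - 1) (B + 1) 1.
have kK x y : `|k x - k y| <= 1 * `|x - y|.
  by rewrite -[X in X * _]invr1; exact: trapezoid_lipschitz.
have k1 x : `|x| <= B -> k x = 1.
  by rewrite ler_norml => /andP[? ?]; apply: trapezoid_in => //; lra.
have k_ge0 x : 0 <= k x := trapezoid_ge0 _ _ _ _.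
have k_le1 x : k x <= 1 := trapezoid_le1 _ _ _ _.
have kn1 x : `|k x| <= 1 by rewrite ger0_norm.
have kB x : B + 1 <= `|x| -> k x = 0.
  rewrite ler_normr => xB; apply: trapezoid_out => //.
  by case/orP: xB => xB; apply/orP; [right|left]; lra.
have mk : measurable_fun setT k.
  exact: continuous_measurable_fun (lipschitz_continuous kK).
have hk : gauss_int h <= gauss_int k.
  apply: le_Rintegral => //; [exact: integrable_gauss..|].
  move=> x _; rewrite ler_wpM2r ?normal_pdf_ge0//.
  have [xB|xB] := leP `|x| B; first by rewrite k1.
  by rewrite hA// (le_trans BA)// ltW.
have hI1 := gauss_int_le1 mh h1; have kI1 := gauss_int_le1 mk kn1.
have hI0 : 0 <= gauss_int h.
  by apply: Rintegral_ge0 => x _; rewrite mulr_ge0 ?normal_pdf_ge0.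
have std_ge0 n : 0 <= std_avg h n.
  by rewrite -[leLHS](perm_avg_cst n 0); apply: perm_avg_le => p.
(* If the mean of k is not positive, neither is that of h, and the claim is trivial; otherwise one
   may divide by it. *)
have [kI0|kI0] := leP (gauss_int k) 0.
  by apply: nearW => n; apply: le_trans (std_ge0 n); lra.
pose c := gauss_int h / gauss_int k.
have c0 : 0 <= c by rewrite divr_ge0// ltW.
have ch : gauss_int h <= c by rewrite ler_pdivlMr// ler_piMr.
pose g x := h x - c * k x.
have gK x y : `|g x - g y| <= (K + c) * `|x - y|.
  have -> : g x - g y = (h x - h y) - c * (k x - k y) by rewrite /g; ring.
  rewrite (le_trans (ler_normB _ _))// mulrDl lerD// normrM (ger0_norm c0).
  by rewrite ler_wpM2l//; have := kK x y; rewrite mul1r.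
have gB x : B + 1 <= `|x| -> g x = 0.
  by move=> xB; rewrite /g kB// hA ?mulr0 ?subr0//; lra.
have g0 : gauss_int g = 0.
  have -> : gauss_int g = gauss_int h - c * gauss_int k.
    rewrite /gauss_int -RintegralZl//; last exact: integrable_gauss.
    rewrite -RintegralB//; [|exact: integrable_gauss|]; last first.
      have := @integrableZl _ _ _ lebesgue_measure setT measurableT c
        _ (integrable_gauss mk kn1).
      by apply: eq_integrable => // x _ /=; rewrite EFinM.
    by congr (Rintegral _ _ _); apply/funext => x; rewrite /g mulrBl mulrA.
  by rewrite /c divfK ?subrr// gt_eqF.
have B10 : 0 < B + 1 by rewrite ltr_wpDr.
have gcvg := cvg_std_avg_stein B10 gK gB g0.
near=> n.
have [dn0 dn] : (0 < d n)%N /\ (2 * d n <= n)%N by near: n; exact: near_small_d.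
have : `|std_avg g n| <= e / 2.
  by near: n; apply: cvgr0_norm_le => //; rewrite divr_gt0.
rewrite ler_norml => /andP[gn _].
have hE : std_avg h n = std_avg g n + c * std_avg k n.
  by rewrite /std_avg -perm_avgZ -perm_avgD; apply: eq_perm_avg => p; rewrite subrK.
(* Chebyshev's inequality in pointwise form: k(W) >= 1 - W^2/B^2. *)
have kn : 1 - e / 2 <= std_avg k n.
  apply: (le_trans (y := 1 - (B ^+ 2)^-1 * 1)); first by rewrite mulr1 lerB.
  rewrite -{2}(stdW_moment2 R dn0 dn) -perm_avgZ -{1}(perm_avg_cst n (1 : R)) -perm_avgB.
  apply: perm_avg_le => p; set W := stdW _ _ _.
  have [WB|BW] := leP `|W| B.
    by rewrite k1// gerBl mulr_ge0 ?sqr_ge0// invr_ge0 sqr_ge0.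
  apply: le_trans (k_ge0 W); rewrite subr_le0 mulrC ler_pdivlMr ?exprn_gt0// mul1r.
  by rewrite -[leRHS]real_normK ?num_real// lerXn2r ?nnegrE// ltW.
have := ler_wpM2l c0 kn; rewrite hE.
have c1 : c <= 1 by rewrite ler_pdivrMr// mul1r.
have : c * (e / 2) <= e / 2 by rewrite ler_piMl// divr_ge0// ltW.
by lra.
Unshelve. all: by end_near. Qed.

Lemma trapezoid_liminf a b w e : 0 < w -> 0 < e ->
  \forall n \near \oo, gauss_cdf (b - w) - gauss_cdf (a + w) - e <=
    std_avg (trapezoid a b w) n.
Proof.
move=> w0 e0.
have t01 x : 0 <= trapezoid a b w x <= 1 by rewrite trapezoid_ge0 trapezoid_le1.
have supp x : `|a| + `|b| <= `|x| -> trapezoid a b w x = 0.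
  move=> abx; apply: trapezoid_out => //.
  have := ler_norm (- a); rewrite normrN => a1.
  have b1 := ler_norm b; have a0 := normr_ge0 a; have b0 := normr_ge0 b.
  by move: abx; rewrite ler_normr => /orP[] ?; apply/orP; [right|left]; lra.
have := std_avg_liminf e0 (fun x y => trapezoid_lipschitz a b x y w0) t01 supp.
apply: filterS => n; apply: le_trans; rewrite lerD2r.
exact: gauss_int_trapezoid.
Qed.

End GaussianLimit.

(** * Tails of the Gaussian distribution function *)

Section GaussianCdf.
Variable R : realType.

(** The identity as a random variable under the normal law, so that the general limits of [cdf] at
    both infinities apply to [gauss_cdf]. *)
Let idR : measurableTypeR R -> R := idfun.

#[local] HB.instance Definition _ :=
  @isMeasurableFun.Build _ _ _ _ idR (@measurable_id _ _ setT).

Let gauss_cdfE : @gauss_cdf R = fine \o cdf (idR : {RV (normal_prob 0 1) >-> R}).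
Proof. by apply/funext => t; rewrite /cdf /= preimage_id. Qed.

Lemma gauss_cdf_tails (e : R) : 0 < e ->
  exists A, gauss_cdf (- A) <= e /\ 1 - e <= gauss_cdf A.
Proof.
move=> e0.
have lo : gauss_cdf t @[t --> -oo] --> (0 : R).
  by rewrite gauss_cdfE; apply: fine_cvg; exact: cvg_cdfNy0.
have hi : gauss_cdf t @[t --> +oo] --> (1 : R).
  by rewrite gauss_cdfE; apply: fine_cvg; exact: cvg_cdfy1.
have /cvgrPdist_le/(_ _ e0)[a [_ aP]] := lo.
have /cvgrPdist_le/(_ _ e0)[b [_ bP]] := hi.
exists (`|a| + `|b| + 1); split.
  have /aP : - (`|a| + `|b| + 1) < a.
    have := ler_norm (- a); rewrite normrN; have := normr_ge0 b; lra.
  by rewrite sub0r normrN => /(le_trans (ler_norm _)).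
have /bP : b < `|a| + `|b| + 1.
  by have := ler_norm b; have := normr_ge0 a; lra.
by move=> /(le_trans (ler_norm _)); lra.
Qed.

End GaussianCdf.

(** * Expectation and variance under the uniform measure on permutations *)

Section UniformPermutation.
Variables (R : realType) (n : nat).
Let P := perm_uniform R n.

(** Every function is a finite combination of indicators of single permutations, each of mass
    1/n!. *)
Lemma integral_perm_uniform (f : 'S_n -> R) :
  (\int[P]_p (f p)%:E)%E = (perm_avg f)%:E.
Proof.
have fE p : (f p)%:E = (\sum_(q : 'S_n) (f q)%:E * (\1_[set q] p)%:E)%E.
  rewrite (bigD1 p)//= big1 => [|q qp].
    by rewrite adde0 indicE mem_set// mule1.
  by rewrite indicE memNset ?mule0//= => pq; rewrite pq eqxx in qp.
under eq_integral do rewrite fE.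
have mset (A : set 'S_n) : measurable A by [].
have iq (q : 'S_n) : P.-integrable setT (fun p => (f q)%:E * (\1_[set q] p)%:E)%E.
  by apply: integrableZl => //; exact: integrable_indic.
rewrite integral_sum// /perm_avg mulr_suml -sumEFin; apply: eq_bigr => q _.
rewrite integralZl//; last exact: integrable_indic.
rewrite integral_indic// setIT [X in (_ * X)%E]perm_uniformE.
rewrite (_ : #|_| = 1%N) ?div1r ?EFinM// -(card1 q); apply: eq_card => p.
by rewrite !inE; apply/idP/eqP; rewrite inE.
Qed.

Lemma expectation_perm (f : 'S_n -> R) : ('E_P[f] = (perm_avg f)%:E)%E.
Proof. by rewrite unlock integral_perm_uniform. Qed.

Lemma variance_perm (f : 'S_n -> R) :
  ('V_P[f] = (perm_avg (fun p => (f p - perm_avg f) ^+ 2)%R)%:E)%E.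
Proof. by rewrite /variance unlock !expectation_perm. Qed.

Lemma perm_uniform_avg (A : pred 'S_n) :
  P [set p | A p] = (perm_avg (fun p => (A p)%:R))%:E.
Proof.
rewrite /P perm_uniformE /perm_avg -sum1_card natr_sum big_mkcond; congr (_ / _)%:E.
apply: eq_bigr => p _; rewrite /in_mem /=.
by rewrite /in_set asboolb; case: (A p).
Qed.

End UniformPermutation.

(** * Convergence of the distribution functions *)

Lemma standardize_descents (R : realType) n d (p : 'S_n) :
  standardize (perm_uniform R n) (d_descentsRV R n d) p = stdW R d p.
Proof.
by rewrite /standardize expectation_perm variance_perm.
Qed.

Lemma cdf_descents (R : realType) n d (x : R) :
  @cdf _ _ R (perm_uniform R n)
    (standardize (perm_uniform R n) (d_descentsRV R n d)) x =
  (perm_avg (fun p : 'S_n => (stdW R d p <= x)%R%:R))%:E.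
Proof.
rewrite -perm_uniform_avg /cdf /distribution /pushforward; congr (perm_uniform R n _).
apply/seteqP; split => p /=; by rewrite in_itv /= standardize_descents.
Qed.

Lemma sqrt_ratio_cvg0 (R : realType) (d : nat -> nat) (eps : R) : 0 < eps ->
  (\forall n \near \oo, (d n)%:R <= n%:R `^ (1 - eps)) ->
  (fun n => Num.sqrt ((d n)%:R / n%:R) : R) @ \oo --> (0 : R).
Proof.
move=> eps0 dP; apply/cvgrPdist_le => e e0; near=> n.
have n0 : (0 < n)%N by near: n; exact: nbhs_infty_gt.
have n0R : 0 < n%:R :> R by rewrite ltr0n.
rewrite sub0r normrN ger0_norm ?sqrtr_ge0//.
rewrite -(ler_pXn2r (n := 2)) ?nnegrE ?sqrtr_ge0// ?(ltW e0)//.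
rewrite sqr_sqrtr ?divr_ge0// ler_pdivrMr//.
have dn : (d n)%:R <= n%:R `^ (1 - eps) by near: n.
apply: (le_trans dn); rewrite powRB ?(gt_eqF n0R) ?implybT// powRr1 ?ler0n//.
have np0 : 0 < n%:R `^ eps :> R by rewrite powR_gt0.
rewrite ler_pdivrMr// mulrAC ler_peMl ?ler0n//.
(* From n = Y^(1/eps) on, n^eps >= e^-2, so that d/n <= n^(-eps) <= e^2. *)
pose Y : R := (e ^+ 2)^-1.
have Y0 : 0 <= Y by rewrite invr_ge0 sqr_ge0.
have nY : Y `^ eps^-1 <= n%:R by near: n; exact: nbhs_infty_ger.
have := ge0_ler_powR (ltW eps0) (powR_ge0 _ _) (ltW n0R) nY.
rewrite -powRrM mulVf ?gt_eqF// powRr1//.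
move/(ler_wpM2l (ltW (exprn_gt0 2 e0))).
by rewrite /Y mulfV// gt_eqF// exprn_gt0.
Unshelve. all: by end_near. Qed.

(** Lower bounds for trapezoids suffice: one supported to the left of x bounds the indicator of W <=
    x from below, and one supported to the right of x bounds its complement from below. *)
Lemma cvg_cdf_descents (R : realType) (d : nat -> nat) (x : R) :
  (forall n, (0 < n)%N -> (0 < d n)%N) ->
  (fun n => Num.sqrt ((d n)%:R / n%:R) : R) @ \oo --> (0 : R) ->
  {for x, continuous (@gauss_cdf R)} ->
  perm_avg (fun p : 'S_n => (stdW R (d n) p <= x)%R%:R) @[n --> \oo] --> gauss_cdf x.
Proof.
move=> d0 dcvg cx; apply/cvgrPdist_le => e e0.
have e4 : 0 < e / 4 by rewrite divr_gt0.
have [r /= r0 rP] : exists2 r : R, 0 < r &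
    forall y, `|x - y| < r -> `|gauss_cdf x - gauss_cdf y| <= e / 4.
  by have /cvgrPdist_le/(_ _ e4)/nbhs_ballP[r r0 rP] := cx; exists r.
pose w := r / 2.
have w0 : 0 < w by rewrite divr_gt0.
have [] : `|gauss_cdf x - gauss_cdf (x - w)| <= e / 4 /\
    `|gauss_cdf x - gauss_cdf (x + w)| <= e / 4.
  split; apply: rP; rewrite ltr_norml /w; apply/andP; split; lra.
rewrite !ler_norml => /andP[_ xl] /andP[xr _].
have [A [A1 A2]] := gauss_cdf_tails e4.
(* The plateaus are [-A, x - w] and [x + w, A]. Each side loses e/4 by continuity at x, e/4 in the
   tail and e/4 in the limit inferior. *)
have lo := trapezoid_liminf d0 dcvg (- A - w) x w0 e4.
have hi := trapezoid_liminf d0 dcvg x (A + w) w0 e4.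
near=> n.
have lon : gauss_cdf (x - w) - gauss_cdf (- A - w + w) - e / 4 <=
    std_avg d (trapezoid (- A - w) x w) n by near: n.
have hin : gauss_cdf (A + w - w) - gauss_cdf (x + w) - e / 4 <=
    std_avg d (trapezoid x (A + w) w) n by near: n.
rewrite subrK in lon; rewrite addrK in hin.
set u := perm_avg _.
have lou : std_avg d (trapezoid (- A - w) x w) n <= u.
  apply: perm_avg_le => p; set W := stdW _ _ _.
  have [Wx|xW] := leP W x; first exact: trapezoid_le1.
  by rewrite trapezoid_out// (ltW xW) orbT.
have hiu : std_avg d (trapezoid x (A + w) w) n <= 1 - u.
  rewrite -[X in X - _](perm_avg_cst n (1 : R)) -perm_avgB.
  apply: perm_avg_le => p; set W := stdW _ _ _.
  have [Wx|xW] := leP W x; last by rewrite subr0 trapezoid_le1.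
  by rewrite trapezoid_out ?Wx// subrr.
by rewrite ler_norml; apply/andP; split; lra.
Unshelve. all: by end_near. Qed.

Theorem theorem3 (R : realType) (d : nat -> nat)
    (d_gt0 : forall n, (0 < n)%N -> (0 < d n)%N)
    (d_small : exists2 eps : R, 0 < eps &
       \forall n \near \oo, (d n)%:R <= n%:R `^ (1 - eps)) :
  cvg_in_distribution (fun n => perm_uniform R n)
    (fun n => standardize (perm_uniform R n) (d_descentsRV R n (d n)))
    (normal_prob 0 1).
Proof.
case: d_small => eps eps0 dP x cx.
(* The normal law is finite on half-lines, so continuity and convergence pass between the extended
   reals and the reals. *)
have fin t : normal_prob 0 1 `]-oo, t] = (gauss_cdf t)%:E :> \bar R.
  by rewrite /gauss_cdf fineK// fin_num_measure.
have cx' : {for x, continuous (@gauss_cdf R)}.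
  by apply: fine_cvg; rewrite -fin; exact: cx.
have : (fun n => (perm_avg (fun p : 'S_n => (stdW R (d n) p <= x)%R%:R))%:E)
    @ \oo --> (gauss_cdf x)%:E.
  apply: cvg_EFin; first exact: nearW.
  exact: (cvg_cdf_descents d_gt0 (sqrt_ratio_cvg0 eps0 dP) cx').
rewrite -fin; apply: cvg_trans; apply: near_eq_cvg; apply: nearW => n.
exact/esym/cdf_descents.
Qed.
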